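(* Let $F:Y^{\mathbb N}\to\mathbb R$, $Y=[-\frac12,\frac12]$, be a smooth mapping. Suppose there exist $\delta\ge1$, $p\in(0,\delta^{-1}]$, a constant $C_F>0$ and a positive sequence $\beta=(\beta_j)_{j\ge1}$ such that $$|\partial^\nu F(\xi)|\le C_F\,\beta^\nu(|\nu|!)^\delta\quad\text{for all }\xi\in Y^{\mathbb N},\ \nu\in\mathcal F,\qquad\text{and}\qquad \|\beta\|_{\ell^p}:=\Big(\sum_{j\ge1}\beta_j^p\Big)^{1/p}<\infty.$$ If $p=\delta^{-1}$, assume additionally that $\|\beta\|_{\ell^p}<\sqrt6$. Let $s\in\mathbb N$ and consider the approximation of $I_s(F)$ by randomly shifted lattice rules $Q^\Delta_{s,n}(F)$ with $n=2^m$ quadrature points, $m\in\mathbb N$. Let $$\vartheta=\begin{cases}\omega\ \text{ for some }\omega\in(\tfrac12,1),&\text{when }p\in(0,\tfrac{2}{3\delta}],\\[4pt]\dfrac{\delta p}{2-\delta p},&\text{when }p\in(\tfrac2{3\delta},\tfrac1\delta],\end{cases}$$ and let the weights be $$\gamma_{\mathfrak u}=\Big((|\mathfrak u|!)^\delta\prod_{j\in\mathfrak u}\frac{\beta_j}{\sqrt{\phi(\vartheta)}}\Big)^{\frac{2}{1+\vartheta}}\quad(\mathfrak u\subseteq\{1,\dots,s\}),\qquad \phi(\vartheta)=\frac{2\zeta(2\vartheta)}{(2\pi^2)^\vartheta}.$$ Then, with the generating vectors $z_s\in\mathbb N^s$ constructed by the component-by-component algorithm for these weights, there exists a constant $C_{s,\gamma,\vartheta}$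 independent of $n$ such that $$\sqrt{\mathbb E\big(|I_s(F)-Q^\Delta_{s,n}(F)|^2\big)}\le C_{s,\gamma,\vartheta}^{1/2}\Big(\frac n2\Big)^{-\frac1{2\vartheta}}.$$
   Context: $\mathcal F$ is the set of finitely supported sequences $\nu=(\nu_1,\nu_2,\dots)$ of nonnegative integers, $|\nu|=\sum_j\nu_j$, $\beta^\nu=\prod_j\beta_j^{\nu_j}$, and $\partial^\nu$ is the corresponding partial derivative. $\zeta$ is the Riemann zeta function. The truncated integral is $I_s(F)=\int_{Y^s}F(y_1,\dots,y_s,0,0,\dots)\,dy_1\cdots dy_s$. For a generating vector $z_s\in\mathbb N^s$ and a random shift $\Delta$ uniformly distributed on $(0,1)^s$, the randomly shifted lattice rule is $$Q^\Delta_{s,n}(F)=\frac1n\sum_{i=1}^nF\Big(\Big\{\frac{i z_s}{n}+\Delta\Big\}-\frac12\Big),$$ where the braces denote the componentwise fractional part, $\frac12$ is subtracted in every component, and the resulting point of $Y^s$ is extended by zeros to a point of $Y^{\mathbb N}$. $\mathbb E$ is the expectation with respect to $\Delta$. The weights $\gamma_{\mathfrak u}$ define the weighted Sobolev space $\mathcal W_\gamma(Y^s)$ with norm $$\|F\|_{\mathcal W_\gamma(Y^s)}^2=\sum_{\mathfrak u\subseteq\{1,\dots,s\}}\frac1{\gamma_{\mathfrak u}}\int_{Y^{|\mathfrak u|}}\Big(\int_{Y^{s-|\mathfrak u|}}\frac{\partial^{|\mathfrak u|}F}{\partial\xi_{\mathfrak u}}(\xi)\,d\xi_{\{1,\dots,s\}\setminus\mathfrak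 u}\Big)^2d\xi_{\mathfrak u}.$$ The component-by-component algorithm sets $z_1=1$ and then, for $k=2,\dots,s$ successively, chooses $z_k\in\{1,\dots,n-1\}$ coprime to $n$ minimizing, with the previous components fixed, the squared shift-averaged worst-case error in the weighted space, $\sum_{\emptyset\ne\mathfrak u\subseteq\{1,\dots,k\}}\gamma_{\mathfrak u}\frac1n\sum_{i=1}^n\prod_{j\in\mathfrak u}B_2(\{iz_j/n\})$, where $B_2(t)=t^2-t+\frac16$. *)

(* Defs.v *)
From HB Require Import structures.
From mathcomp Require Import all_boot all_order all_algebra finmap.
From mathcomp Require Import all_classical all_reals all_analysis.

Set Implicit Arguments.
Unset Strict Implicit.
Unset Printing Implicit Defensive.

Import Order.TTheory GRing.Theory Num.Theory.
Import numFieldNormedType.Exports.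

Local Open Scope classical_set_scope.
Local Open Scope ring_scope.

(* Sequences indexed by j >= 1 are indexed here by nat from 0, and the index
   set {1, ..., s} is 'I_s.  A function on Y^N is a total function on nat -> R;
   every notion below only inspects its values on Y^N. *)

Definition Y (R : realType) : set R := `[- 2^-1, 2^-1].

Definition YN (R : realType) : set (nat -> R) := [set xi | forall j, Y (xi j)].

(* Difference quotient in direction e_j. *)
Definition dquot (R : realType) (j : nat) (G : (nat -> R) -> R)
    (xi : nat -> R) (h : R) : R :=
  h^-1 * (G [eta xi with j |-> xi j + h] - G xi).

(* Nonzero increments h -> 0 that keep xi_j + h in Y: derivatives are
   one-sided at the endpoints of Y. *)
Definition Yincr (R : realType) (x : R) : set_system R :=
  within [set h | Y (x + h)] (0 : R)^'.

Definition pderivable (R : realType) (j : nat) (G : (nat -> R) -> R)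
    (xi : nat -> R) : Prop :=
  cvg (dquot j G xi h @[h --> Yincr (xi j)]).

Definition partial (R : realType) (j : nat) (G : (nat -> R) -> R)
    (xi : nat -> R) : R :=
  lim (dquot j G xi h @[h --> Yincr (xi j)]).

(* Iterated partial derivatives of all orders exist on Y^N and are continuous
   in any finite number of variables.  This is implied both by smoothness for
   the product topology and by smoothness for the sup norm. *)
Definition smooth (R : realType) (F : (nat -> R) -> R) : Prop :=
  forall l : seq nat, let G := foldr (@partial R) F l in
    (forall j xi, YN xi -> pderivable j G xi) /\
    (forall (k : nat) xi, YN xi ->
       {within (@YN R : set {ptws nat -> R}), continuous (fun y : {ptws nat -> R} =>
          G (fun j => if (j < k)%N then y j else xi j))}).

Definition mindex := {fsfun nat -> nat with 0%N}.

Definition mlen (nu : mindex) : nat := (\sum_(j <- finsupp nu) nu j)%N.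

Definition mpow (R : realType) (beta : nat -> R) (nu : mindex) : R :=
  \prod_(j <- finsupp nu) beta j ^+ nu j.

Definition mpartial (R : realType) (nu : mindex) (F : (nat -> R) -> R) :
    (nat -> R) -> R :=
  foldr (fun j => iter (nu j) (partial j)) F (sort leq (finsupp nu)).

Definition lpnorm (R : realType) (p : R) (beta : nat -> R) : \bar R :=
  ((\sum_(0 <= j <oo) (beta j `^ p)%:E) `^ p^-1)%E.

(* Integral over the product set D^s, as an iterated Lebesgue integral. *)
Fixpoint cube_integral (R : realType) (D : set R) (s : nat) :
    (s.-tuple R -> R) -> R :=
  match s with
  | 0 => fun f => f (nil_tuple R)
  | s'.+1 => fun f =>
      (\int[@lebesgue_measure R]_(t in D)
          cube_integral D (fun y : s'.-tuple R => f (cons_tuple (t : R) y)))%R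
  end.

Definition ext0 (R : realType) (s : nat) (y : s.-tuple R) : nat -> R :=
  nth 0 y.

Definition trunc_integral (R : realType) (s : nat) (F : (nat -> R) -> R) : R :=
  cube_integral (@Y R) (fun y : s.-tuple R => F (ext0 y)).

Definition frac_part (R : realType) (t : R) : R := t - (Num.floor t)%:~R.

Definition lattice_rule (R : realType) (s n : nat) (z : 'I_s -> nat)
    (F : (nat -> R) -> R) (Delta : s.-tuple R) : R :=
  n%:R^-1 * \sum_(1 <= i < n.+1)
    F (ext0 [tuple frac_part ((i * z j)%:R / n%:R + tnth Delta j) - 2^-1 | j < s]).

(* Expectation of f(Delta) for Delta uniform on (0,1)^s. *)
Definition shift_expectation (R : realType) (s : nat) (f : s.-tuple R -> R) :
    R :=
  cube_integral `]0, 1[%classic f.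

Definition zeta (R : realType) (x : R) : R :=
  limn (series (fun k : nat => (k.+1%:R : R) `^ (- x))).

Definition phi (R : realType) (theta : R) : R :=
  2 * zeta (2 * theta) / (2 * pi ^+ 2) `^ theta.

Definition vartheta (R : realType) (delta p omega : R) : R :=
  if p <= 2 / (3 * delta) then omega else delta * p / (2 - delta * p).

Definition weight (R : realType) (delta theta : R) (beta : nat -> R) (s : nat)
    (u : {set 'I_s}) : R :=
  ((#|u| `!)%:R `^ delta * \prod_(j in u) (beta j / Num.sqrt (phi theta)))
    `^ (2 / (1 + theta)).

Definition B2 (R : realType) (t : R) : R := t ^+ 2 - t + 6^-1.

(* Squared shift-averaged worst-case error of the first k components of z. *)
Definition sq_error (R : realType) (s n : nat) (gamma : {set 'I_s} -> R)
    (k : nat) (z : 'I_s -> nat) : R :=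
  \sum_(u : {set 'I_s} | (u != finset.set0) &&
                         (u \subset [set j : 'I_s | (j < k)%N]%SET))
    gamma u * (n%:R^-1 * \sum_(1 <= i < n.+1)
                 \prod_(j in u) B2 (frac_part ((i * z j)%:R / n%:R))).

(* z is a possible output of the component-by-component algorithm; ties in the
   minimization may be broken arbitrarily. *)
Definition cbc (R : realType) (s n : nat) (gamma : {set 'I_s} -> R)
    (z : 'I_s -> nat) : Prop :=
  forall k : 'I_s,
    if (k == 0 :> nat)%N then z k = 1%N else
    [/\ (0 < z k < n)%N, coprime (z k) n &
        forall c : nat, (0 < c < n)%N -> coprime c n ->
          sq_error n gamma k.+1 z <= sq_error n gamma k.+1 [eta z with k |-> c]].

(* Main.v *)
Require Import Defs.
From mathcomp Require Import all_boot all_order all_algebra finmap.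
From mathcomp Require Import all_classical all_reals all_analysis.
From mathcomp Require Import ring lra zify.

Set Implicit Arguments.
Unset Strict Implicit.
Unset Printing Implicit Defensive.

Import Order.TTheory GRing.Theory Num.Theory.
Import numFieldNormedType.Exports.

Local Open Scope classical_set_scope.
Local Open Scope ring_scope.

(** Write [B] for the Bernoulli polynomial [B2] and let
    [mean_z u = 1/n sum_i prod_(j in u) B {i z_j / n}], so that the squared
    worst-case error is [sum_u gamma_u mean_z u] over the nonempty [u].  The
    theorem follows from two independent bounds.

    Mean square error.  For a function of one variable,
    [f x = int f + int f' t k(x, t) dt] with a bounded kernel [k]
    ([has_int_anova]).  Expanding one coordinate after the other shows, by
    induction on the dimension, that the square of any functional
    [c int f + sum_i a_i f (x_i)] is at most [2^s M^2] times
    [c^2 + 2 c sum_i a_i + sum_(i, l) a_i a_l prod_j (1 + cov (x_i)_j (x_l)_j)],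
    where [cov x y = int k(x, t) k(y, t) dt] and [M] bounds the mixed first
    derivatives ([functional_sq_le]).  Since [f] is smooth, such an [M] exists
    by compactness of the cube ([smooth_mixed_c1]).  Averaged over the shift,
    [cov] becomes [B] of the fractional part of the difference
    ([has_int_shift_cov]), and differences of lattice points are lattice
    points, so the mean square error is at most
    [2^s M^2 sum_(u nonempty) mean_z u] ([shift_mse_le]).

    Component-by-component construction.  On the integers modulo [n] the
    function [i |-> B {i / n}] is a finite cosine sum with explicit nonnegative
    coefficients [c_h] ([B2_cos_expansion]).  Let [1/2 < lam <= 1].  If the
    components before [k] are fixed, then [mean_z u] with [k] in [u] is a
    nonnegative combination of terms [c_h a_l 1_(n | h z_k +- l)].  By subadditivity of [t^lam], the sum over all
    [z_k] of its [lam]-th power is at most a constant times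
    [sum_h c_h^lam gcd h n], because [h z = l mod n] has at most [gcd h n]
    solutions.  For [n = 2^m] this sum stays bounded as [m] grows, exactly
    because [2 lam > 1] ([gcd_mass_le]).  The minimum over the [n / 2] odd
    candidates is at most their mean, which gives
    [gamma_u mean_z u <= K (n / 2)^(-1 / lam)] ([cbc_lattice_mean_le]).  Taking
    [lam] to be the number [vartheta] of the theorem finishes the proof. *)

(** * Cosine expansion of the Bernoulli polynomial on a finite cyclic group *)

Definition wave (R : realType) (n : nat) (k : int) : R :=
  cos (2 * pi * k%:~R / n%:R).

Lemma cos_add_2pi_nat (R : realType) (x : R) (q : nat) :
  cos (x + 2 * pi * q%:R) = cos x.
Proof.
rewrite -(periodicn (@cosD2pi R) q x); congr cos.
by rewrite -[in RHS]mulr_natr -[pi *+ 2]mulr_natl.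
Qed.

Lemma waveN (R : realType) n k : wave R n (- k) = wave R n k.
Proof. by rewrite /wave rmorphN /= mulrN mulNr cosN. Qed.

Lemma wave0 (R : realType) n : wave R n 0 = 1.
Proof. by rewrite /wave mulr0 mul0r cos0. Qed.

Lemma wave_period (R : realType) n (k q : int) :
  (0 < n)%N -> wave R n (k + n%:Z * q) = wave R n k.
Proof.
move=> n0; have nn0 : (n%:R : R) != 0 by rewrite pnatr_eq0 -lt0n.
have pos (l : int) (r : nat) : wave R n (l + n%:Z * r%:Z) = wave R n l.
  rewrite /wave -[RHS](cos_add_2pi_nat _ r); congr cos.
  by rewrite rmorphD rmorphM /=; field.
case: (intP q) => [|r|r]; first by rewrite mulr0 addr0.
  exact: pos.
by rewrite -[LHS](pos _ r.+1); congr (wave R n _); ring.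
Qed.

Lemma wave_mul (R : realType) n (k l : int) :
  wave R n k * wave R n l = 2^-1 * (wave R n (k + l) + wave R n (k - l)).
Proof.
rewrite /wave rmorphB rmorphD /= [2 * pi * (_ + _)]mulrDr.
by rewrite [2 * pi * (_ - _)]mulrBr mulrDl mulrBl cosD cosB; field.
Qed.

Lemma sin_pi_ne0 (R : realType) (x : R) : 0 < x < 1 -> sin (pi * x) != 0.
Proof.
move=> /andP[x0 x1]; rewrite gt_eqF// sin_gt0_pi//.
by rewrite mulr_gt0 ?pi_gt0//= gtr_pMr ?pi_gt0.
Qed.

(** Multiplying by [2 sin (pi k / n)] turns the sum into a telescoping one. *)
Lemma sum_wave_small (R : realType) n (k : nat) : (0 < k < n)%N ->
  \sum_(1 <= i < n.+1) wave R n (k%:Z * i%:Z) = 0.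
Proof.
move=> /andP[k0 kn]; have n0 : (0 < n)%N by apply: leq_trans kn.
have nn0 : (n%:R : R) != 0 by rewrite pnatr_eq0 -lt0n.
pose a : R := pi * (k%:R / n%:R).
have sa : sin a != 0.
  apply: sin_pi_ne0; rewrite divr_gt0 ?ltr0n//=.
  by rewrite ltr_pdivrMr ?ltr0n// mul1r ltr_nat.
have s2a : 2 * sin a != 0 by rewrite mulf_neq0// pnatr_eq0.
apply: (mulfI s2a); rewrite mulr0 mulr_sumr.
pose t i : R := sin (a * (i.*2.+1%:R - 2)).
rewrite (eq_bigr (fun i => t i.+1 - t i)); last first.
  move=> i _; rewrite /t /wave.
  have -> : a * (i.+1.*2.+1%:R - 2) = a * i.*2%:R + a.
    rewrite -[i.+1.*2.+1]/(i.*2.+3) -addn3 natrD; ring.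
  have -> : a * (i.*2.+1%:R - 2) = a * i.*2%:R - a.
    rewrite -addn1 natrD; ring.
  have -> : 2 * pi * (k%:Z * i%:Z)%:~R / n%:R = a * i.*2%:R.
    by rewrite /a rmorphM /= -muln2 natrM; field.
  rewrite sinD sinB; ring.
rewrite telescope_sumr// /t.
have -> : a * (n.+1.*2.+1%:R - 2) = a + (pi *+ 2) *+ k.
  rewrite -[n.+1.*2.+1]/(n.*2.+3) -addn3 natrD -muln2 natrM.
  by rewrite -[pi *+ 2 *+ k]mulr_natr -[pi *+ 2]mulr_natr /a; field.
rewrite (periodicn (@sinD2pi R)).
have -> : a * (3 - 2) = a by ring.
by rewrite subrr.
Qed.

Lemma sum_wave (R : realType) n (k : int) : (0 < n)%N ->
  \sum_(1 <= i < n.+1) wave R n (k * i%:Z) = if (n%:Z %| k)%Z then n%:R else 0.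
Proof.
move=> n0.
have nz : n%:Z != 0 by rewrite eqz_nat -lt0n.
have [r [rn kE]] : exists r : nat, (r < n)%N /\ k = r%:Z + n%:Z * (k %/ n%:Z)%Z.
  exists `|(k %% n%:Z)%Z|%N; rewrite gez0_abs ?modz_ge0//; split.
    by rewrite -ltz_nat gez0_abs ?modz_ge0// ltz_pmod.
  by rewrite {1}(divz_eq k n%:Z) addrC mulrC.
rewrite (eq_bigr (fun i => wave R n (r%:Z * i%:Z))); last first.
  by move=> i _; rewrite kE mulrDl -mulrA wave_period.
have -> : (n%:Z %| k)%Z = (r == 0)%N.
  rewrite kE rpredDr ?dvdz_mulr// dvdzE !absz_nat.
  by case: r rn {kE} => [|r] rn; rewrite ?dvdn0// gtnNdvd.
have [->|r0] := eqVneq r 0%N; last by rewrite sum_wave_small// lt0n r0.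
rewrite (eq_bigr (fun=> 1)); last by move=> i _; rewrite mul0r wave0.
by rewrite sumr_const_nat subn1.
Qed.

(** The discrete Fourier coefficients of [i |-> B2 (i / n)], for [0 <= i < n]. *)
Definition B2_coef (R : realType) (n h : nat) : R :=
  if h == 0%N then (6 * n%:R ^+ 2)^-1
  else (2 * n%:R ^+ 2 * sin (pi * (h%:R / n%:R)) ^+ 2)^-1.

Lemma B2_coef_ge0 (R : realType) n h : 0 <= B2_coef R n h.
Proof.
rewrite /B2_coef; case: ifP => _; rewrite invr_ge0.
  by rewrite mulr_ge0 ?ler0n ?sqr_ge0.
by rewrite mulr_ge0 ?sqr_ge0// mulr_ge0 ?ler0n ?sqr_ge0.
Qed.

Lemma frac_part_ratio (R : realType) n (k : nat) : (0 < n)%N ->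
  frac_part (k%:R / n%:R : R) = (k %% n)%:R / n%:R.
Proof.
move=> n0; have nn0 : (n%:R : R) != 0 by rewrite pnatr_eq0 -lt0n.
rewrite /frac_part (@floor_def _ _ (k %/ n)%:Z).
  rewrite {1}(divn_eq k n) natrD natrM; field; exact: nn0.
rewrite -[(_ + 1)%R]/((k %/ n)%:Z + 1%:Z) -PoszD addn1 /=.
rewrite ler_pdivlMr ?ltr0n// ltr_pdivrMr ?ltr0n// -!natrM ler_nat ltr_nat.
by rewrite leq_trunc_div/= ltn_ceil.
Qed.

Lemma B2_frac_le (R : realType) n (k : nat) : (0 < n)%N -> (k <= n)%N ->
  B2 (frac_part (k%:R / n%:R : R)) = B2 (k%:R / n%:R).
Proof.
move=> n0; rewrite leq_eqVlt => /orP[/eqP->|kn]; rewrite frac_part_ratio//.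
  by rewrite modnn divff ?pnatr_eq0 -?lt0n// mul0r /B2; ring.
by rewrite modn_small.
Qed.

(** On [{0, ..., n}] the difference of the two sides has vanishing second
    differences and equal values at [0] and [n], so it is constant; the
    constant is its mean over a period, namely [0]. *)
Lemma B2_cos_expansion (R : realType) n (k : nat) : (0 < n)%N ->
  B2 (frac_part (k%:R / n%:R : R)) =
  \sum_(0 <= h < n) B2_coef R n h * wave R n (h%:Z * k%:Z).
Proof.
move=> n0; have nn0 : (n%:R : R) != 0 by rewrite pnatr_eq0 -lt0n.
pose S (k : nat) := \sum_(0 <= h < n) B2_coef R n h * wave R n (h%:Z * k%:Z).
pose D k := S k - B2 (k%:R / n%:R : R).
have second (i : nat) : (i.+1 < n)%N -> D i.+2 - 2 * D i.+1 + D i = 0.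
  move=> i1n.
  have S2 : S i.+2 - 2 * S i.+1 + S i = 2 / n%:R ^+ 2.
    rewrite /S mulr_sumr -sumrB -big_split /=.
    pose G h : R := - (2 / n%:R ^+ 2) * wave R n (i.+1%:Z * h%:Z).
    rewrite (eq_big_nat _ _ (F2 := fun h => if h == 0%N then 0 else G h)).
      rewrite big_ltn// eqxx add0r.
      rewrite (eq_big_nat _ _ (F2 := G)); last by move=> h /andP[]; case: h.
      have := sum_wave_small R (k := i.+1) (n := n) i1n.
      rewrite big_nat_recr//= => /eqP; rewrite addr_eq0 => /eqP sw.
      rewrite -mulr_sumr sw; have -> : wave R n (i.+1%:Z * n%:Z) = 1.
        by rewrite mulrC -[_ * _]add0r wave_period// wave0.
      ring.
    move=> h /andP[_ hn].
    pose a : R := pi * (h%:R / n%:R).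
    have w2 : wave R n (h%:Z * i.+2%:Z) + wave R n (h%:Z * i%:Z) =
        2 * (1 - 2 * sin a ^+ 2) * wave R n (h%:Z * i.+1%:Z).
      have -> : 1 - 2 * sin a ^+ 2 = wave R n h%:Z.
        rewrite /wave (_ : 2 * pi * _ / _ = a *+ 2); last first.
          by rewrite /a -mulr_natr/=; field.
        rewrite cos_mulr2n cos2sin2 -mulr_natr; ring.
      rewrite -mulrA wave_mul mulVKf ?pnatr_eq0// -[wave R n (_ - _)]waveN.
      congr (wave R n _ + wave R n _); lia.
    rewrite (_ : _ - _ + _ = B2_coef R n h *
      (wave R n (h%:Z * i.+2%:Z) + wave R n (h%:Z * i%:Z)
       - 2 * wave R n (h%:Z * i.+1%:Z))); last by ring.
    rewrite w2 /G /B2_coef [i.+1%:Z * _]mulrC.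
    case: eqP => [h0|/eqP h0].
      by rewrite /a h0 mul0r mulr0 sin0; ring.
    rewrite -/a; field; rewrite nn0/=; apply: sin_pi_ne0.
    rewrite divr_gt0 ?ltr0n// ?lt0n//= ltr_pdivrMr ?ltr0n//.
    by rewrite mul1r ltr_nat.
  rewrite (_ : _ - _ + _ = (S i.+2 - 2 * S i.+1 + S i) -
    (B2 (i.+2%:R / n%:R) - 2 * B2 (i.+1%:R / n%:R) + B2 (i%:R / n%:R)));
    last by rewrite /D; ring.
  rewrite S2 /B2 -(addn2 i) -(addn1 i) !natrD; field; exact: nn0.
have affine i : (i.+1 <= n)%N ->
    D i = D 0%N + i%:R * (D 1%N - D 0%N) /\
    D i.+1 = D 0%N + i.+1%:R * (D 1%N - D 0%N).
  elim: i => [_|i IH i2n]; first by split; ring.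
  have [e1 e2] := IH (ltnW i2n); split=> //.
  have /eqP := second i i2n; rewrite addrAC subr_eq0 => /eqP.
  rewrite e1 e2 => e3; rewrite -[LHS](addrK (D i)) e1 e3.
  rewrite -(addn2 i) -(addn1 i) !natrD; ring.
have Dn : D n = D 0%N.
  rewrite /D; congr (_ - _).
    apply: eq_bigr => h _; rewrite mulr0 mulrC [h%:Z * _]mulrC.
    by rewrite -[_ * h%:Z]add0r wave_period// mulrC.
  by rewrite divff// mul0r /B2; ring.
have D1 : D 1%N - D 0%N = 0.
  case: n n0 nn0 @S @D second affine Dn => // n _ nn0 S D _ affine Dn.
  have [_] := affine n (leqnn _); rewrite Dn => /esym /eqP.
  rewrite -subr_eq0 addrAC subrr add0r mulf_eq0 (negbTE nn0) /= => /eqP //.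
have Dc i : (i <= n)%N -> D i = D 0%N.
  by case: i => // i /affine[_ ->]; rewrite D1 mulr0 addr0.
have D0 : D 0%N = 0.
  have : \sum_(1 <= i < n.+1) D i = n%:R * D 0%N.
    rewrite (eq_big_nat _ _ (F2 := fun=> D 0%N)).
      by rewrite sumr_const_nat subn1 mulr_natl.
    by move=> i /andP[_]; rewrite ltnS => /Dc.
  rewrite /D sumrB /S exchange_big /=.
  rewrite (eq_big_nat _ _ (F2 := fun h => if h == 0%N then (6 * n%:R)^-1 else 0)).
    rewrite big_ltn//= big_nat_cond big1 ?addr0; last first.
      by move=> h /andP[/andP[]]; case: h.
    have sumB N : \sum_(1 <= i < N.+1) B2 (i%:R / n%:R : R) =
       N%:R * (N%:R + 1) * (2 * N%:R + 1) / (6 * n%:R ^+ 2)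
       - N%:R * (N%:R + 1) / (2 * n%:R) + N%:R / 6.
      elim: N => [|N IH]; first by rewrite big_geq//; ring.
      rewrite big_nat_recr//= IH /B2 -addn1 natrD; field; exact: nn0.
    rewrite sumB (_ : (6 * n%:R)^-1 - _ = 0); last by field; exact: nn0.
    move=> /esym/eqP; by rewrite mulf_eq0 (negbTE nn0) => /eqP.
  move=> h /andP[_ hn]; rewrite -mulr_sumr sum_wave// dvdzE !absz_nat.
  case: eqP => [->|/eqP h0]; first by rewrite dvdn0 /B2_coef eqxx; field.
  by rewrite gtnNdvd ?lt0n// mulr0.
have Slt r : (r <= n)%N -> B2 (frac_part (r%:R / n%:R : R)) = S r.
  by move=> rn; rewrite B2_frac_le//; apply/eqP; rewrite eq_sym -subr_eq0 -/(D r) Dc// D0.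
have -> : frac_part (k%:R / n%:R : R) = frac_part ((k %% n)%:R / n%:R).
  by rewrite !frac_part_ratio// modn_mod.
rewrite Slt ?(ltnW (ltn_pmod _ _))//; apply: eq_bigr => h _; congr (_ * _).
rewrite {2}(divn_eq k n) PoszD PoszM.
by rewrite -(@wave_period R n _ (h%:Z * (k %/ n)%:Z))//; congr (wave R n _); ring.
Qed.

(** * Power sums of the coefficients, weighted by gcds *)

(** On [0, 1] the power [t `^ lam] is at least [t]; this is used for
    [x / (x + y)] and [y / (x + y)], which add up to [1]. *)
Lemma powRD_le (R : realType) (lam x y : R) : 0 < lam <= 1 -> 0 <= x -> 0 <= y ->
  (x + y) `^ lam <= x `^ lam + y `^ lam.
Proof.
move=> /andP[l0 l1] x0 y0.
have [xy0|xyn0] := eqVneq (x + y) 0.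
  by rewrite xy0 powR0 ?gt_eqF// addr_ge0 ?powR_ge0.
have s0 : 0 < x + y by rewrite lt_neqAle eq_sym xyn0 addr_ge0.
have part z : 0 <= z -> z <= x + y -> (x + y) `^ lam * (z / (x + y)) <= z `^ lam.
  move=> z0 zs; have [->|zn0] := eqVneq z 0; first by rewrite mul0r mulr0 powR_ge0.
  have zp : 0 < z by rewrite lt_neqAle eq_sym zn0.
  rewrite -[in leRHS](divfK xyn0 z) [_ * (x + y)]mulrC.
  rewrite powRM ?(ltW s0) ?divr_ge0 ?(ltW s0)// ler_pM2l ?powR_gt0//.
  by rewrite ger1_powR// divr_gt0//= ler_pdivrMr// mul1r.
have := lerD (part x x0 _) (part y y0 _).
rewrite -mulrDr -mulrDl divff// mulr1; apply; lra.
Qed.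

Lemma powR_sum_le (R : realType) (lam : R) (I : Type) (r : seq I) (P : pred I)
    (F : I -> R) : 0 < lam <= 1 -> (forall i, P i -> 0 <= F i) ->
  (\sum_(i <- r | P i) F i) `^ lam <= \sum_(i <- r | P i) F i `^ lam.
Proof.
move=> lam01 F0; elim: r => [|i r IH].
  by rewrite !big_nil powR0// gt_eqF//; case/andP: lam01.
rewrite !big_cons; case: ifP => // Pi.
by apply: (le_trans (powRD_le _ _ _)); rewrite ?F0 ?sumr_ge0// lerD2l.
Qed.

Lemma sum_even_odd (R : realType) (f : nat -> R) (N : nat) :
  \sum_(0 <= i < N.*2) f i =
  \sum_(0 <= i < N) f i.*2 + \sum_(0 <= i < N) f i.*2.+1.
Proof.
elim: N => [|N IH]; first by rewrite !big_geq// addr0.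
by rewrite doubleS !big_nat_recr//= IH -!addrA; congr (_ + _); rewrite addrCA.
Qed.

Lemma powR2_lt1 (R : realType) (s : R) : s < 0 -> (2 : R) `^ s < 1.
Proof.
move=> s0; have -> : s = - - s by rewrite opprK.
rewrite powRN invf_lt1 ?powR_gt0// /powR pnatr_eq0 /=.
by rewrite expR_gt1 mulr_gt0 ?oppr_gt0// ln_gt0// ltr1n.
Qed.

(** Let [T] be the sum.  Replacing each odd base above [1] by the even number
    before it shows that the sum of length [2 N] is at most [1 + 2^(1-s) T], and
    it is at least [T]. *)
Lemma riemann_sum_le (R : realType) (s : R) (N : nat) : 1 < s ->
  \sum_(0 <= i < N) (i.+1%:R : R) `^ (- s) <= (1 - 2 `^ (1 - s))^-1.
Proof.
move=> s1; set T := \sum_(0 <= i < N) _.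
have q1 : (2 : R) `^ (1 - s) < 1 by rewrite powR2_lt1// subr_lt0.
have q2 : (2 : R) `^ (1 - s) = 2 * 2 `^ (- s).
  by rewrite powRD ?powRr1// pnatr_eq0/= implybT.
have even i : ((i.*2.+2)%:R : R) `^ (- s) = 2 `^ (- s) * i.+1%:R `^ (- s).
  by rewrite -powRM// -natrM mul2n.
have TT : T <= \sum_(0 <= i < N.*2) (i.+1%:R : R) `^ (- s).
  rewrite -addnn (@big_cat_nat _ _ _ N)//= ?leq_addr// lerDl.
  by rewrite sumr_ge0// => i _; rewrite powR_ge0.
rewrite leNgt; apply/negP => bad.
move: TT; rewrite sum_even_odd.
have -> : \sum_(0 <= i < N) ((i.*2.+2)%:R : R) `^ (- s) = 2 `^ (- s) * T.
  by rewrite mulr_sumr; apply: eq_bigr => i _; exact: even.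
have : \sum_(0 <= i < N) (i.*2.+1%:R : R) `^ (- s) <= 1 + 2 `^ (- s) * T.
  rewrite /T; case: (N) => [|M].
    by rewrite !big_geq// mulr0 addr0.
  rewrite big_nat_recl//= powR1 lerD2l mulr_sumr big_nat_recr//=.
  rewrite -[leLHS]addr0 lerD ?mulr_ge0 ?powR_ge0//.
  apply: ler_sum => i _; rewrite -even doubleS.
  rewrite !powRN lef_pV2 ?posrE ?powR_gt0// ge0_ler_powR ?nnegrE//; first by lra.
  by rewrite ler_nat.
move: bad; rewrite -subr_gt0 => bad.
have : 0 < (T - (1 - 2 `^ (1 - s))^-1) * (1 - 2 `^ (1 - s)).
  by rewrite mulr_gt0// subr_gt0.
rewrite mulrBl mulVf ?gt_eqF ?subr_gt0// q2; lra.
Qed.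

Lemma zeta_gt0 (R : realType) (s : R) : 1 < s -> 0 < zeta s.
Proof.
move=> s1; rewrite /zeta.
set u := series _.
have nd : nondecreasing_seq u.
  by apply: nondecreasing_series => k _ _; rewrite powR_ge0.
have ub : has_ubound (range u).
  by exists (1 - 2 `^ (1 - s))^-1 => _ [N _ <-]; exact: riemann_sum_le.
have cu : cvgn u by exact: nondecreasing_is_cvgn.
apply: (lt_le_trans (y := u 1%N)).
  by rewrite /u /series/= big_nat1 powR1.
by apply: limr_ge => //; near=> N; apply: nd; near: N; exact: nbhs_infty_ge.
Unshelve. all: by end_near. Qed.

Lemma cos_ge_half (R : realType) (y : R) : 0 <= y <= pi / 4 -> 2^-1 <= cos y.
Proof.
move=> /andP[y0 y1]; have p0 := @pi_gt0 R.
have c0 : 0 <= cos y by apply: cos_ge0_pihalf; lra.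
have c2 : 0 <= cos (y *+ 2) by apply: cos_ge0_pihalf; rewrite -mulr_natr; lra.
have := cos_le1 y; rewrite cos_mulr2n -mulr_natr in c2; nra.
Qed.

(** A weak form of Jordan's inequality, from [sin x = 2 sin (x/2) cos (x/2)] and
    [cos >= 1/2] on [0, pi/4]. *)
Lemma sin_ge_quarter (R : realType) (x : R) : 0 <= x <= pi / 2 -> x / 4 <= sin x.
Proof.
move=> /andP[x0 x1]; have p0 := @pi_gt0 R.
have y2 : x = (x / 2) *+ 2 by rewrite -mulr_natr; lra.
have c : 2^-1 <= cos (x / 2) by apply: cos_ge_half; lra.
have s : (x / 2) / 2 <= sin (x / 2).
  have y0 : 0 <= x / 2 by lra.
  have [t tin] : exists2 t, t \in `[0, x / 2] &
      sin (x / 2) - sin 0 = cos t * (x / 2 - 0).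
    apply: (@MVT_segment R sin cos 0 (x / 2) y0).
    by apply: continuous_subspaceT => t; exact: continuous_sin.
  rewrite sin0 !subr0 => ->; have : 2^-1 <= cos t.
    by apply: cos_ge_half; move: tin; rewrite in_itv/=; lra.
  nra.
by rewrite [in leRHS]y2 sin_mulr2n -mulr_natr; nra.
Qed.

Lemma B2_coef_le (R : realType) n h : (0 < h)%N -> (h.*2 <= n)%N ->
  B2_coef R n h <= 2 / h%:R ^+ 2.
Proof.
move=> h0 hn; have n0 : (0 < n)%N by apply: leq_trans hn; rewrite double_gt0.
have n0R : 0 < n%:R :> R by rewrite ltr0n.
have h0R : 0 < h%:R :> R by rewrite ltr0n.
have hnR : 2 * h%:R <= n%:R :> R by rewrite -natrM ler_nat mul2n.
have p2 := @pi_ge2 R.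
have r0 : 0 < h%:R / n%:R :> R by rewrite divr_gt0.
have r2 : h%:R / n%:R <= 2^-1 :> R by rewrite ler_pdivrMr//; lra.
have s : h%:R / n%:R / 2 <= sin (pi * (h%:R / n%:R)) :> R.
  have := @sin_ge_quarter R (pi * (h%:R / n%:R)).
  have -> : 0 <= pi * (h%:R / n%:R : R) <= pi / 2 by apply/andP; split; nra.
  by move=> /(_ isT); apply: le_trans; nra.
rewrite /B2_coef gtn_eqF// -[leRHS]invrK lef_pV2 ?posrE ?invr_gt0 ?divr_gt0 ?exprn_gt0//.
  have -> : (2 / h%:R ^+ 2)^-1 = 2 * n%:R ^+ 2 * (h%:R / n%:R / 2) ^+ 2 :> R.
    by field; rewrite !gt_eqF.
  rewrite ler_pM2l ?mulr_gt0 ?exprn_gt0// ler_pXn2r// ?nnegrE; last exact: le_trans s.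
  by rewrite divr_ge0// ltW.
rewrite mulr_gt0 ?exprn_gt0// ?mulr_gt0 ?exprn_gt0//.
by apply: lt_le_trans s; rewrite divr_gt0.
Qed.

Lemma B2_coef_sym (R : realType) n h : (0 < h < n)%N ->
  B2_coef R n (n - h) = B2_coef R n h.
Proof.
move=> /andP[h0 hn]; have n0 : (0 < n)%N by apply: leq_trans hn.
rewrite /B2_coef subn_eq0 leqNgt hn /= gtn_eqF//.
rewrite natrB ?(ltnW hn)// (_ : pi * _ = - (pi * (h%:R / n%:R)) + pi); last first.
  by field; rewrite pnatr_eq0 -lt0n.
by rewrite sinDpi sinN opprK.
Qed.

(** A residue modulo [n] that is a multiple of [h] is hit by [gcdn h n] of the
    products [h z] with [z < n], whence the weights. *)
Definition gcd_mass (R : realType) (lam : R) (n : nat) : R :=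
  \sum_(0 <= h < n) B2_coef R n h `^ lam * (gcdn h n)%:R.

Definition riemann_bound (R : realType) (lam : R) : R :=
  (1 - 2 `^ (1 - 2 * lam))^-1.

Lemma riemann_bound_ge1 (R : realType) (lam : R) : 2^-1 < lam ->
  1 <= riemann_bound lam.
Proof.
move=> l2; rewrite /riemann_bound.
have q1 : (2 : R) `^ (1 - 2 * lam) < 1 by rewrite powR2_lt1//; lra.
have := powR_ge0 (2 : R) (1 - 2 * lam).
by rewrite invf_ge1 ?subr_gt0//; lra.
Qed.

(** Splitting into even and odd [h] gives [S (m+1) <= Z + 2^(1-2 lam) S m],
    where [Z] bounds the sum over odd [h], for which the gcd is [1]. *)
Lemma dyadic_gcd_sum_le (R : realType) (lam : R) (m : nat) : 2^-1 < lam ->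
  \sum_(0 <= h < 2 ^ m) (h%:R : R) `^ (- (2 * lam)) * (gcdn h (2 ^ m))%:R
    <= riemann_bound lam ^+ 2.
Proof.
move=> l2; have Z1 := riemann_bound_ge1 l2.
have q1 : (2 : R) `^ (1 - 2 * lam) < 1 by rewrite powR2_lt1//; lra.
have lnz : - (2 * lam) != 0 by rewrite lt_eqF//; lra.
elim: m => [|m IH].
  by rewrite expn0 big_nat1 powR0// mul0r; nra.
rewrite expnS mul2n sum_even_odd.
have -> : \sum_(0 <= i < 2 ^ m) (i.*2%:R : R) `^ (- (2 * lam)) *
      (gcdn i.*2 (2 ^ m).*2)%:R = 2 `^ (1 - 2 * lam) *
    \sum_(0 <= h < 2 ^ m) (h%:R : R) `^ (- (2 * lam)) * (gcdn h (2 ^ m))%:R.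
  rewrite mulr_sumr; apply: eq_bigr => i _.
  rewrite -!mul2n -muln_gcdr !natrM powRM// powRD ?pnatr_eq0 ?implybT// powRr1//.
  ring.
have odd_le : \sum_(0 <= i < 2 ^ m) (i.*2.+1%:R : R) `^ (- (2 * lam)) *
      (gcdn i.*2.+1 (2 ^ m).*2)%:R <= riemann_bound lam.
  have := @riemann_sum_le R (2 * lam) (2 ^ m) ltac:(lra).
  apply: le_trans; apply: ler_sum => i _.
  rewrite (_ : gcdn _ _ = 1%N) ?mulr1; last first.
    have : coprime i.*2.+1 (2 * 2 ^ m).
      by rewrite -expnS coprimeXr// coprimen2 /= odd_double.
    by rewrite mul2n => /eqP.
  rewrite !powRN lef_pV2 ?posrE ?powR_gt0// ge0_ler_powR ?nnegrE//; first by lra.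
  by rewrite ler_nat ltnS -addnn leq_addr.
have := @ler_wpM2l R (2 `^ (1 - 2 * lam)) (powR_ge0 _ _) _ _ IH.
have e : riemann_bound lam ^+ 2 * (1 - 2 `^ (1 - 2 * lam)) = riemann_bound lam.
  rewrite /riemann_bound; field; rewrite gt_eqF// subr_gt0//.
lra.
Qed.

Definition gcd_mass_bound (R : realType) (lam : R) : R :=
  1 + 4 * riemann_bound lam ^+ 2.

Lemma gcd_mass_bound_ge1 (R : realType) (lam : R) : 1 <= gcd_mass_bound lam.
Proof. by rewrite /gcd_mass_bound lerDl mulr_ge0// sqr_ge0. Qed.

(** The coefficients at [h] and [n - h] agree, so each of them is bounded by the
    estimate for whichever of the two is at most [n / 2].  The term [h = 0]
    carries the weight [n], which its coefficient of order [n^-2] absorbs. *)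
Lemma gcd_mass_le (R : realType) (lam : R) (m : nat) : 2^-1 < lam <= 1 ->
  gcd_mass lam (2 ^ m) <= gcd_mass_bound lam.
Proof.
move=> /andP[l2 l1]; set n := (2 ^ m)%N.
have n0 : (0 < n)%N by rewrite expn_gt0.
have n1R : 1 <= n%:R :> R by rewrite ler1n.
rewrite /gcd_mass big_ltn// gcd0n lerD//.
  rewrite /B2_coef eqxx -powR_inv1; last by rewrite mulr_ge0// sqr_ge0.
  rewrite -powRrM mulN1r powRN ler_pdivrMl ?powR_gt0 ?mulr_gt0 ?exprn_gt0 ?ltr0n//.
  rewrite mulr1; apply: (le_trans (y := (6 * n%:R ^+ 2) `^ 2^-1)); last first.
    by apply: ler_powR; [nra|rewrite ltW].
  rewrite powR12_sqrt ?mulr_ge0 ?sqr_ge0// -[leLHS]ger0_norm// -sqrtr_sqr.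
  by rewrite ler_wsqrtr//; nra.
pose f h : R := (h%:R : R) `^ (- (2 * lam)) * (gcdn h n)%:R.
have f0 h : 0 <= f h by rewrite mulr_ge0 ?powR_ge0.
have Sf : \sum_(1 <= h < n) f h <= riemann_bound lam ^+ 2.
  have := dyadic_gcd_sum_le m l2; rewrite -/n big_ltn// -/(f 0%N).
  by apply: le_trans; rewrite lerDr.
have half h : (0 < h)%N -> (h.*2 <= n)%N ->
    B2_coef R n h `^ lam <= 2 * (h%:R : R) `^ (- (2 * lam)).
  move=> h0 hn; have h0R : 0 < h%:R :> R by rewrite ltr0n.
  apply: (le_trans (y := (2 / h%:R ^+ 2) `^ lam)).
    apply: ge0_ler_powR; rewrite ?nnegrE ?B2_coef_ge0//; first by lra.
    exact: B2_coef_le.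
  rewrite powRM// ?invr_ge0 ?sqr_ge0// ler_pM ?powR_ge0//.
    by rewrite -[leRHS]powRr1// ler_powR// ler1n.
  by rewrite -powR_invn// -powRrM mulNr.
apply: (le_trans (y := \sum_(1 <= h < n) 2 * (f h + f (n - h)%N))).
  apply: ler_sum_nat => h /andP[h0 hn].
  have gE : gcdn (n - h) n = gcdn h n.
    have gcd_sub N : (h < N)%N -> gcdn (N - h) N = gcdn h N.
      by move=> /ltnW /subnK {2 3}<-; rewrite gcdnDl gcdnDr gcdnC.
    exact: gcd_sub.
  rewrite /f gE -mulrDl mulrA ler_wpM2r//.
  have [hh|hh] := leqP h.*2 n.
    by apply: (le_trans (half h h0 hh)); rewrite ler_pM2l// lerDl powR_ge0.
  rewrite -B2_coef_sym ?h0//.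
  apply: (le_trans (half (n - h)%N _ _)); first by rewrite subn_gt0.
    by lia.
  by rewrite ler_pM2l// lerDr powR_ge0.
rewrite -mulr_sumr big_split /= [X in _ + X]big_nat_rev /=.
have -> : \sum_(1 <= i < n) f (n - (1 + n - i.+1))%N = \sum_(1 <= h < n) f h.
  by apply: eq_big_nat => i /andP[i0 i1]; congr f; lia.
lra.
Qed.

(** * Cosine polynomials and their means along multiples *)

(** Frequencies may repeat in the list, so that products need no collection of
    terms. *)
Definition cos_poly (R : realType) (lam : R) (n : nat) (A : R) (g : nat -> R) :=
  exists L : seq (R * int),
    [/\ (forall t, t \in L -> 0 <= t.1),
        (forall i, g i = \sum_(t <- L) t.1 * wave R n (t.2 * i%:Z)) &
        \sum_(t <- L) t.1 `^ lam <= A].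

Lemma cos_poly_eq (R : realType) (lam : R) n A (g h : nat -> R) :
  g =1 h -> cos_poly lam n A g -> cos_poly lam n A h.
Proof. by move=> gh [L [L0 Lg LA]]; exists L; split => // i; rewrite -gh. Qed.

Lemma cos_poly_one (R : realType) (lam : R) n : cos_poly lam n 1 (fun=> 1).
Proof.
exists [:: (1, 0)]; split.
- by move=> t; rewrite inE => /eqP->/=.
- by move=> i; rewrite big_seq1 mul0r wave0 mulr1.
- by rewrite big_seq1 powR1.
Qed.

Lemma cos_poly_mul (R : realType) (lam : R) n A B (g h : nat -> R) :
  0 <= lam -> cos_poly lam n A g -> cos_poly lam n B h ->
  cos_poly lam n (2 * A * B) (fun i => g i * h i).
Proof.
move=> l0 [L [L0 Lg LA]] [K [K0 Kh KB]].
pose mk (sg : int) (t u : R * int) : R * int := (t.1 * u.1 / 2, t.2 + sg * u.2).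
have pos sg w : w \in [seq mk sg t u | t <- L, u <- K] -> 0 <= w.1.
  case/allpairsP=> -[t u]/= [tL uK ->]/=.
  by have t0 := L0 _ tL; have u0 := K0 _ uK; rewrite divr_ge0// mulr_ge0.
have mass sg : \sum_(w <- [seq mk sg t u | t <- L, u <- K]) w.1 `^ lam <= A * B.
  rewrite big_allpairs_dep /=.
  apply: (le_trans (y := \sum_(t <- L) \sum_(u <- K) t.1 `^ lam * u.1 `^ lam)).
    rewrite big_seq [leRHS]big_seq; apply: ler_sum => t tL.
    rewrite big_seq [leRHS]big_seq; apply: ler_sum => u uK.
    have t0 := L0 _ tL; have u0 := K0 _ uK.
    rewrite -powRM//; apply: ge0_ler_powR; rewrite ?nnegrE ?divr_ge0 ?mulr_ge0//.
    by rewrite ler_pdivrMr// ler_peMr ?mulr_ge0// ler1n.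
  under eq_bigr do rewrite -mulr_sumr.
  by rewrite -mulr_suml ler_pM// ?sumr_ge0// => *; rewrite ?powR_ge0.
exists ([seq mk 1 t u | t <- L, u <- K] ++ [seq mk (-1) t u | t <- L, u <- K]).
split.
- by move=> w; rewrite mem_cat => /orP[] /pos.
- move=> i; rewrite Lg Kh big_cat /= !big_allpairs_dep /= -big_split /=.
  rewrite mulr_suml; apply: eq_bigr => t _.
  rewrite mulr_sumr -big_split /=; apply: eq_bigr => u _.
  by rewrite mul1r mulN1r mulrDl mulrBl mulrACA wave_mul; field.
- by rewrite big_cat /= (_ : 2 * A * B = A * B + A * B) ?lerD//; ring.
Qed.

Lemma cos_poly_mean_ge0 (R : realType) (lam : R) n A (g : nat -> R) : (0 < n)%N ->
  cos_poly lam n A g -> 0 <= n%:R^-1 * \sum_(1 <= i < n.+1) g i.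
Proof.
move=> n0 [L [L0 Lg _]]; rewrite mulr_ge0 ?invr_ge0//.
under eq_bigr do rewrite Lg.
rewrite exchange_big /= big_seq sumr_ge0// => t tL.
rewrite -mulr_sumr sum_wave// mulr_ge0 ?L0//.
by case: ifP.
Qed.

Lemma cos_poly_B2 (R : realType) (lam : R) m z : 2^-1 < lam <= 1 ->
  let n := (2 ^ m)%N in
  cos_poly lam n (gcd_mass_bound lam)
    (fun i => B2 (frac_part ((i * z)%:R / n%:R : R))).
Proof.
move=> lam01 n; have n0 : (0 < n)%N by rewrite expn_gt0.
exists [seq (B2_coef R n h, h%:Z * z%:Z) | h <- index_iota 0 n]; split.
- by move=> t /mapP[h _ ->]; exact: B2_coef_ge0.
- move=> i; rewrite B2_cos_expansion// big_map; apply: eq_bigr => h _ /=.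
  by congr (_ * wave R n _); rewrite PoszM; ring.
- apply: le_trans (gcd_mass_le m lam01); rewrite big_map /gcd_mass -/n.
  apply: ler_sum => h _; rewrite ler_peMr ?powR_ge0// ler1n.
  by rewrite gcdn_gt0 n0 orbT.
Qed.

Lemma cos_poly_prod (R : realType) (lam : R) m (I : Type) (r : seq I) (z : I -> nat) :
  2^-1 < lam <= 1 ->
  let n := (2 ^ m)%N in
  cos_poly lam n ((2 * gcd_mass_bound lam) ^+ size r)
    (fun i => \prod_(j <- r) B2 (frac_part ((i * z j)%:R / n%:R : R))).
Proof.
move=> lam01 n; elim: r => [|j r IH].
  by apply: cos_poly_eq (cos_poly_one lam n) => i; rewrite big_nil.
have l0 : 0 <= lam by lra.
rewrite /= exprS.
apply: (cos_poly_eq _ (cos_poly_mul l0 (cos_poly_B2 m (z j) lam01) IH)) => i.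
by rewrite big_cons.
Qed.

(** Two solutions are congruent modulo [n / gcd h n]. *)
Lemma count_multiples_le (R : realType) n h (l : int) : (0 < n)%N ->
  \sum_(0 <= z < n) ((n%:Z %| h%:Z * z%:Z + l)%Z : nat)%:R <= (gcdn h n)%:R :> R.
Proof.
move=> n0; rewrite -natr_sum ler_nat.
pose P (z : nat) := (n%:Z %| h%:Z * z%:Z + l)%Z.
set g := gcdn h n; have g0 : (0 < g)%N by rewrite gcdn_gt0 n0 orbT.
have gn : (g %| n)%N by exact: dvdn_gcdr.
set d := (n %/ g)%N; have d0 : (0 < d)%N by rewrite divn_gt0// dvdn_leq.
have nE : n = (d * g)%N by rewrite divnK.
rewrite (_ : (\sum_(0 <= z < n) _)%N = size [seq z <- index_iota 0 n | P z]);
  last first.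
  by rewrite size_filter -sum1_count [RHS]big_mkcond /P; apply: eq_bigr => z _; case: ifP.
rewrite -(size_map (fun z => (z %/ d)%N)) -[leqRHS](size_iota 0).
apply: uniq_leq_size; last first.
  move=> q /mapP[z]; rewrite mem_filter mem_index_iota => /andP[_ /andP[_ zn]] ->.
  by rewrite mem_iota /= add0n ltn_divLR// mulnC -nE.
rewrite map_inj_in_uniq ?filter_uniq ?iota_uniq// => z z'.
rewrite !mem_filter => /andP[Pz _] /andP[Pz' _] zz'.
suff : (z = z' %[mod d])%N.
  by move=> e; rewrite (divn_eq z d) (divn_eq z' d) zz' e.
have := rpredB Pz Pz'; rewrite opprD addrACA subrr addr0 -mulrBr.
rewrite -/(_ \is a _) => dv.
have {}dv : ((d * g)%N%:Z %| (h %/ g * g)%N%:Z * (z%:Z - z'%:Z))%Z.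
  by rewrite -nE divnK ?dvdn_gcdl.
have cop : coprimez d%:Z (h %/ g)%N%:Z.
  rewrite coprimezE !absz_nat /coprime -(eqn_pmul2r g0) mul1n muln_gcdl.
  by rewrite -nE divnK ?dvdn_gcdl// gcdnC.
move: dv; rewrite !PoszM mulrAC dvdz_mul2r ?eqz_nat -?lt0n// Gauss_dvdzr//.
by rewrite -eqz_mod_dvd => /eqP; rewrite !modz_nat => -[].
Qed.

(** By subadditivity of [t `^ lam] it is enough to treat pairs of frequencies
    [h] and [l], for which the mean over [i] only tests whether [n] divides
    [h z + l] or [h z - l]; the sum over [z] then counts solutions. *)
Lemma sum_pow_mean_le (R : realType) (lam : R) m A (g : nat -> R) :
  2^-1 < lam <= 1 ->
  let n := (2 ^ m)%N in
  cos_poly lam n A g ->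
  \sum_(0 <= z < n) (n%:R^-1 * \sum_(1 <= i < n.+1)
      B2 (frac_part ((i * z)%:R / n%:R)) * g i) `^ lam
  <= 2 * gcd_mass_bound lam * A.
Proof.
move=> lam01 n [L [L0 Lg LA]].
have lamP : 0 < lam <= 1 by lra.
have n0 : (0 < n)%N by rewrite expn_gt0.
have nn0 : (n%:R : R) != 0 by rewrite pnatr_eq0 -lt0n.
pose e (k : int) : R := ((n%:Z %| k)%Z : nat)%:R.
have e01 k : e k = 0 \/ e k = 1 by rewrite /e; case: (_ %| _)%Z; [right|left].
have TE z : n%:R^-1 * (\sum_(1 <= i < n.+1) B2 (frac_part ((i * z)%:R / n%:R)) * g i) =
    \sum_(0 <= h < n) \sum_(t <- L) B2_coef R n h * t.1 *
      (2^-1 * (e (h%:Z * z%:Z + t.2) + e (h%:Z * z%:Z - t.2))).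
  under eq_bigr => i _ do rewrite B2_cos_expansion// Lg mulr_suml.
  rewrite exchange_big /= mulr_sumr; apply: eq_bigr => h _.
  under eq_bigr do rewrite mulr_sumr.
  rewrite exchange_big /= mulr_sumr; apply: eq_bigr => t _.
  have se k : \sum_(1 <= i < n.+1) wave R n (k * i%:Z) = n%:R * e k.
    by rewrite sum_wave// /e; case: (_ %| _)%Z; rewrite ?mulr1 ?mulr0.
  rewrite (eq_bigr (fun i => B2_coef R n h * t.1 * (2^-1 *
      (wave R n ((h%:Z * z%:Z + t.2) * i%:Z) +
       wave R n ((h%:Z * z%:Z - t.2) * i%:Z))))); last first.
    move=> i _; rewrite mulrACA wave_mul PoszM.
    congr (_ * (_ * (wave R n _ + wave R n _))); ring.
  rewrite -!mulr_sumr big_split /= !se; field; exact: nn0.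
have e_pow k l : (2^-1 * (e k + e l)) `^ lam <= e k + e l.
  have half : (2^-1 : R) `^ lam <= 1.
    apply: (le_trans (y := 1 `^ lam)); last by rewrite powR1.
    by apply: ge0_ler_powR; rewrite ?nnegrE; lra.
  have ln0 : lam != 0 by rewrite gt_eqF//; lra.
  case: (e01 k) => ->; case: (e01 l) => ->; rewrite ?(addr0, add0r, mulr1, mulr0) ?powR0//.
  by rewrite (_ : 2^-1 * (1 + 1) = 1 :> R) ?powR1; lra.
have e0 k l : 0 <= 2^-1 * (e k + e l) by rewrite mulr_ge0// addr_ge0.
have pow_le z : (n%:R^-1 * \sum_(1 <= i < n.+1)
      B2 (frac_part ((i * z)%:R / n%:R)) * g i) `^ lam <=
    \sum_(0 <= h < n) \sum_(t <- L) B2_coef R n h `^ lam * t.1 `^ lam *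
      (e (h%:Z * z%:Z + t.2) + e (h%:Z * z%:Z - t.2)).
  have term0 h t : t \in L -> 0 <= B2_coef R n h * t.1 *
      (2^-1 * (e (h%:Z * z%:Z + t.2) + e (h%:Z * z%:Z - t.2))).
    by move=> tL; rewrite mulr_ge0// mulr_ge0 ?B2_coef_ge0 ?L0.
  rewrite TE; apply: le_trans (powR_sum_le _ lamP _) _.
    by move=> h _; rewrite big_seq sumr_ge0// => t; exact: term0.
  apply: ler_sum => h _; rewrite big_seq.
  apply: le_trans (powR_sum_le _ lamP _) _; first by move=> t; exact: term0.
  rewrite [leRHS]big_seq; apply: ler_sum => t tL.
  rewrite powRM// ?mulr_ge0 ?B2_coef_ge0 ?L0//.
  by rewrite powRM ?B2_coef_ge0 ?L0// ler_wpM2l// mulr_ge0 ?powR_ge0.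
apply: (le_trans (ler_sum _ (fun z _ => pow_le z))).
rewrite exchange_big /=.
apply: (le_trans (y := \sum_(0 <= h < n) \sum_(t <- L)
    B2_coef R n h `^ lam * t.1 `^ lam * (2 * (gcdn h n)%:R))).
  apply: ler_sum => h _; rewrite exchange_big /=; apply: ler_sum => t _.
  rewrite -mulr_sumr ler_wpM2l ?mulr_ge0 ?powR_ge0// big_split /=.
  have := @count_multiples_le R n h t.2 n0.
  have := @count_multiples_le R n h (- t.2) n0; rewrite /e; lra.
have -> : \sum_(0 <= h < n) \sum_(t <- L)
    B2_coef R n h `^ lam * t.1 `^ lam * (2 * (gcdn h n)%:R) =
    2 * gcd_mass lam n * \sum_(t <- L) t.1 `^ lam.
  rewrite /gcd_mass mulr_sumr mulr_suml; apply: eq_bigr => h _.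
  by rewrite mulr_sumr; apply: eq_bigr => t _; ring.
rewrite -!mulrA ler_pM2l// ler_pM ?gcd_mass_le// ?sumr_ge0// => *;
  by rewrite ?mulr_ge0 ?powR_ge0.
Qed.

(** * The component-by-component construction *)

(** The term of the squared worst-case error that belongs to [u]. *)
Definition lattice_mean (R : realType) (s n : nat) (z : 'I_s -> nat)
    (u : {set 'I_s}) : R :=
  n%:R^-1 * \sum_(1 <= i < n.+1)
    \prod_(j in u) B2 (frac_part ((i * z j)%:R / n%:R)).

Lemma lattice_mean_ge0 (R : realType) (s m : nat) (z : 'I_s -> nat) u :
  0 <= lattice_mean R (2 ^ m) z u.
Proof.
rewrite /lattice_mean; apply: (@cos_poly_mean_ge0 _ 1); first by rewrite expn_gt0.
apply: cos_poly_eq (cos_poly_prod m (enum u) z _); last by lra.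
by move=> i; rewrite big_enum.
Qed.

(** Only the frequency [0] survives, so the value does not depend on [c]. *)
Lemma mean_B2_coprime (R : realType) n c : (0 < n)%N -> coprime c n ->
  n%:R^-1 * \sum_(1 <= i < n.+1) B2 (frac_part ((i * c)%:R / n%:R)) =
  B2_coef R n 0.
Proof.
move=> n0 cop; have nn0 : (n%:R : R) != 0 by rewrite pnatr_eq0 -lt0n.
under eq_bigr => i _ do rewrite B2_cos_expansion//.
rewrite exchange_big /= big_ltn//= [X in _ + X]big_nat_cond [X in _ + X]big1 ?addr0.
  under eq_bigr => i _ do rewrite mul0r wave0 mulr1.
  by rewrite sumr_const_nat subn1 /= -[X in _ * X]mulr_natl mulKf.
move=> h /andP[/andP[h0 hn] _]; rewrite -mulr_sumr.
under eq_bigr => i _ do rewrite PoszM mulrCA mulrC.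
rewrite sum_wave// dvdzE abszM !absz_nat Gauss_dvdl; last by rewrite coprime_sym.
by rewrite gtnNdvd// mulr0.
Qed.

(** The part of the squared error of the first [k + 1] components that depends
    on the choice of component [k]. *)
Definition last_error (R : realType) (s n : nat) (gamma : {set 'I_s} -> R)
    (z : 'I_s -> nat) (k : 'I_s) : R :=
  \sum_(v : {set 'I_s} | (k \in v) && (v \subset [set j : 'I_s | (j < k.+1)%N]%SET))
    gamma v * lattice_mean R n z v.

(** For [k > 0] the terms without [k] cancel in the minimality condition.  The
    component [k = 0] is not chosen by minimization, but there the error is the
    same for all candidates. *)
Lemma last_error_cbc_le (R : realType) (s m : nat) (gamma : {set 'I_s} -> R)
    (z : 'I_s -> nat) (k : 'I_s) (c : nat) :
  let n := (2 ^ m)%N in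
  cbc n gamma z -> (0 < c < n)%N -> coprime c n ->
  last_error n gamma z k <= last_error n gamma [eta z with k |-> c] k.
Proof.
move=> n cz c0n cop; have n0 : (0 < n)%N by rewrite expn_gt0.
have := cz k; case: eqP => [k0 zk|_ [zk0 zkc /(_ c c0n cop)]].
  rewrite /last_error le_eqVlt; apply/orP; left; apply/eqP; apply: eq_bigr => v.
  move=> /andP[kv /fintype.subsetP vk].
  have -> : v = [set k]%SET.
    apply/setP => j; rewrite finset.in_set1; apply/idP/eqP => [jv|->//].
    apply/val_inj => /=; have := vk j jv; rewrite inE k0 ltnS leqn0 => /eqP //.
  rewrite /lattice_mean; congr (_ * _).
  under eq_bigr do rewrite big_set1.
  under [in RHS]eq_bigr do rewrite big_set1 /= eqxx.
  by rewrite mean_B2_coprime// ?mean_B2_coprime// zk coprime1n.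
have split_error y : sq_error n gamma k.+1 y = last_error n gamma y k +
    \sum_(v : {set 'I_s} | (v != finset.set0) &&
      (v \subset [set j : 'I_s | (j < k.+1)%N]%SET) && (k \notin v))
      gamma v * lattice_mean R n y v.
  rewrite /sq_error (bigID (fun v : {set 'I_s} => k \in v)) /=; congr (_ + _).
  rewrite /last_error; apply: eq_bigl => v; rewrite [RHS]andbC; case kv: (k \in v).
    have v0 : v != finset.set0 by apply/finset.set0Pn; exists k.
    by rewrite v0.
  by rewrite andbF andbF.
rewrite !split_error.
suff -> : \sum_(v : {set 'I_s} | (v != finset.set0) &&
      (v \subset [set j : 'I_s | (j < k.+1)%N]%SET) && (k \notin v))
      gamma v * lattice_mean R n [eta z with k |-> c] v =
    \sum_(v : {set 'I_s} | (v != finset.set0) &&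
      (v \subset [set j : 'I_s | (j < k.+1)%N]%SET) && (k \notin v))
      gamma v * lattice_mean R n z v by rewrite lerD2r.
apply: eq_bigr => v /andP[_ kv]; rewrite /lattice_mean; congr (_ * (_ * _)).
apply: eq_bigr => i _; apply: eq_bigr => j jv /=.
by rewrite ifN//; apply: contraNneq kv => <-.
Qed.

(** The minimum over the [n / 2] odd candidates is at most the mean of order
    [lam], for which [sum_pow_mean_le] gives the bound. *)
Lemma cbc_lattice_mean_le (R : realType) (lam : R) (s : nat)
    (gamma : {set 'I_s} -> R) : 2^-1 < lam <= 1 -> (forall v, 0 < gamma v) ->
  exists2 K : R, 0 < K & forall m (z : 'I_s -> nat) (u : {set 'I_s}), (0 < m)%N ->
    cbc (2 ^ m) gamma z -> u != finset.set0 ->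
    gamma u * lattice_mean R (2 ^ m) z u <= K * ((2 ^ m)%:R / 2) `^ (- lam^-1).
Proof.
move=> lam01 g0; have lamP : 0 < lam <= 1 by lra.
have l0 : 0 < lam by lra.
pose W := gcd_mass_bound lam; have W1 : 1 <= W := gcd_mass_bound_ge1 lam.
pose D := \sum_(v : {set 'I_s}) gamma v `^ lam * (2 * W * (2 * W) ^+ s).
have D0 : 0 < D.
  rewrite /D (bigD1 finset.set0)//= ltr_pwDl//.
    rewrite mulr_gt0 ?powR_gt0// mulr_gt0 ?exprn_gt0//; lra.
  rewrite sumr_ge0// => v _; rewrite mulr_ge0 ?powR_ge0// mulr_ge0 ?exprn_ge0//; lra.
exists (D `^ lam^-1); first by rewrite powR_gt0.
move=> m z u m0 cz u0; set n := (2 ^ m)%N.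
have [k ku kmax] : exists2 k, k \in u & forall j, j \in u -> (j <= k)%N.
  have /finset.set0Pn[k0 k0u] := u0.
  by case: (arg_maxnP (fun j : 'I_s => nat_of_ord j) k0u) => k ku kmax; exists k.
set X := last_error n gamma z k.
have term_ge0 y v : 0 <= gamma v * lattice_mean R n y v.
  by rewrite mulr_ge0 ?lattice_mean_ge0// ltW.
have uX : gamma u * lattice_mean R n z u <= X.
  rewrite /X /last_error (bigD1 u) /=; last first.
    by rewrite ku; apply/fintype.subsetP => j /kmax; rewrite inE ltnS.
  by rewrite lerDl sumr_ge0.
have X0 : 0 <= X by apply: le_trans uX.
apply: (le_trans uX).
have nE : n = (2 ^ m.-1).*2 by rewrite -mul2n -expnS prednK.
have n0 : (0 < n)%N by rewrite expn_gt0.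
have n2 : n%:R / 2 = (2 ^ m.-1)%:R :> R.
  by rewrite nE -mul2n natrM mulrC mulKf.
have h0 : 0 < (2 ^ m.-1)%:R :> R by rewrite ltr0n expn_gt0.
have avg : (2 ^ m.-1)%:R * X `^ lam <= D.
  apply: (le_trans (y := \sum_(0 <= c < n)
      last_error n gamma [eta z with k |-> c] k `^ lam)).
    rewrite (_ : index_iota 0 n = index_iota 0 (2 ^ m.-1).*2); last by rewrite -nE.
    rewrite sum_even_odd -[leLHS]add0r lerD//.
      by rewrite sumr_ge0// => c _; rewrite powR_ge0.
    rewrite mulr_natl -[X in _ *+ X](subn0 (2 ^ m.-1)%N) -sumr_const_nat.
    apply: ler_sum_nat => w /andP[_ wn].
    apply: ge0_ler_powR; rewrite ?nnegrE ?(ltW l0)//.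
      by rewrite sumr_ge0.
    apply: last_error_cbc_le => //.
      by rewrite -/n nE -(doubleS w) leq_double.
    by rewrite coprimeXr// coprimen2 /= odd_double.
  apply: (le_trans (y := \sum_(0 <= c < n)
      \sum_(v : {set 'I_s} | k \in v)
        (gamma v * lattice_mean R n [eta z with k |-> c] v) `^ lam)).
    apply: ler_sum => c _; apply: le_trans (powR_sum_le _ lamP _) _ => //.
    rewrite big_mkcondr /=; apply: ler_sum => v _.
    by case: ifP => // _; rewrite powR_ge0.
  rewrite exchange_big /= /D [leRHS](bigID (fun v : {set 'I_s} => k \in v)) /=.
  rewrite -[leLHS]addr0 lerD//; last first.
    rewrite sumr_ge0// => v _; rewrite mulr_ge0 ?powR_ge0// mulr_ge0 ?exprn_ge0//; lra.
  apply: ler_sum => v kv.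
  pose r := enum (v :\ k)%SET.
  pose g i := \prod_(j <- r) B2 (frac_part ((i * z j)%:R / n%:R : R)).
  have gP : cos_poly lam n ((2 * W) ^+ size r) g by exact: cos_poly_prod.
  have meanE c : lattice_mean R n [eta z with k |-> c] v = n%:R^-1 *
      \sum_(1 <= i < n.+1) B2 (frac_part ((i * c)%:R / n%:R)) * g i.
    rewrite /lattice_mean; congr (_ * _); apply: eq_bigr => i _.
    rewrite (big_setD1 k)//= eqxx; congr (_ * _).
    rewrite /g /r big_enum /=; apply: eq_bigr => j; rewrite !inE => /andP[jk _].
    by rewrite ifN.
  under eq_bigr => c _ do rewrite powRM ?lattice_mean_ge0 ?(ltW (g0 v))// meanE.
  rewrite -mulr_sumr ler_wpM2l ?powR_ge0//.
  apply: (le_trans (sum_pow_mean_le lam01 gP)).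
  rewrite -/W ler_wpM2l//; first by lra.
  rewrite ler_weXn2l//; first by lra.
  by rewrite /r -cardE (leq_trans (max_card _))// card_ord.
rewrite n2.
have -> : X = (X `^ lam) `^ lam^-1 by rewrite -powRrM divff ?gt_eqF// powRr1.
have -> : D `^ lam^-1 * (2 ^ m.-1)%:R `^ (- lam^-1) = (D / (2 ^ m.-1)%:R) `^ lam^-1.
  rewrite powRM ?invr_ge0 ?(ltW D0) ?(ltW h0)// -[X in _ = _ * X `^ _]powR_inv1 ?(ltW h0)//.
  by rewrite -[in RHS]powRrM mulN1r.
apply: ge0_ler_powR; rewrite ?nnegrE ?invr_ge0 ?powR_ge0 ?(ltW l0)//.
  by rewrite divr_ge0// ltW.
by rewrite ler_pdivlMr// mulrC.
Qed.

(** * Integrals of one real variable *)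

(** Integrability together with the value.  Open intervals make the values of
    [f] at break points irrelevant. *)
Definition has_int (R : realType) (a b : R) (f : R -> R) (v : R) : Prop :=
  (@lebesgue_measure R).-integrable `]a, b[ (EFin \o f) /\
  \int[@lebesgue_measure R]_(x in `]a, b[) f x = v.

Lemma has_int_eq (R : realType) (a b : R) (f g : R -> R) v w :
  (forall x, a < x < b -> f x = g x) -> v = w -> has_int a b f v ->
  has_int a b g w.
Proof.
move=> fg <- [If <-]; split.
  apply: eq_integrable If => // x; rewrite inE /= in_itv /= => xab.
  by rewrite /= fg.
by apply: eq_Rintegral => x; rewrite inE /= in_itv /= => xab; rewrite fg.
Qed.

Lemma has_intD (R : realType) (a b : R) (f g : R -> R) v w :
  has_int a b f v -> has_int a b g w -> has_int a b (fun x => f x + g x) (v + w).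
Proof.
move=> [If <-] [Ig <-]; split; last by rewrite RintegralD.
have : (@lebesgue_measure R).-integrable `]a, b[ ((EFin \o f) \+ (EFin \o g))%E.
  by apply: integrableD => //; exact: measurable_itv.
by apply: eq_integrable => //; exact: measurable_itv.
Qed.

Lemma has_intZ (R : realType) (a b c : R) (f : R -> R) v :
  has_int a b f v -> has_int a b (fun x => c * f x) (c * v).
Proof.
move=> [If <-]; split; last by rewrite RintegralZl.
have : (@lebesgue_measure R).-integrable `]a, b[ (fun x => c%:E * (EFin \o f) x)%E.
  by apply: integrableZl => //; exact: measurable_itv.
by apply: eq_integrable => //; exact: measurable_itv.
Qed.

Lemma has_int_cst (R : realType) (a b c : R) : a <= b ->
  has_int a b (fun=> c) (c * (b - a)).
Proof.
move=> ab; split.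
  have cI : (@lebesgue_measure R).-integrable `[a, b] (EFin \o fun=> c).
    apply: continuous_compact_integrable; first exact: segment_compact.
    by apply: continuous_subspaceT => x; exact: cvg_cst.
  apply: integrableS cI => //; exact: subset_itv_oo_cc.
rewrite Rintegral_cst//= lebesgue_measure_itv/= lte_fin.
case: ltP => [_|ba]; first by rewrite -EFinB.
by rewrite (le_anti (introT andP (conj ab ba))) subrr.
Qed.

Lemma has_int_sum (R : realType) (a b : R) (I : Type) (r : seq I)
    (f : I -> R -> R) (v : I -> R) : a <= b ->
  (forall i, has_int a b (f i) (v i)) ->
  has_int a b (fun x => \sum_(i <- r) f i x) (\sum_(i <- r) v i).
Proof.
move=> ab fv; elim: r => [|i r IH].
  apply: has_int_eq (has_int_cst 0 ab) => [x _|]; first by rewrite big_nil.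
  by rewrite big_nil mul0r.
by apply: has_int_eq (has_intD (fv i) IH) => [x _|]; rewrite big_cons.
Qed.

Lemma has_int_le (R : realType) (a b : R) (f g : R -> R) v w :
  (forall x, a < x < b -> f x <= g x) ->
  has_int a b f v -> has_int a b g w -> v <= w.
Proof.
move=> fg [If <-] [Ig <-]; by apply: le_Rintegral => // x; rewrite /= in_itv /=; exact: fg.
Qed.

(** The integral of a nonnegative function is a supremum over the simple
    functions below it, and those below [f] are also below [g]. *)
Lemma Rintegral_le_dom (R : realType) (a b : R) (f g : R -> R) w :
  (forall x, a < x < b -> 0 <= f x <= g x) -> has_int a b g w ->
  0 <= \int[@lebesgue_measure R]_(x in `]a, b[) f x <= w.
Proof.
move=> fg [Ig <-].
have f0 x : `]a, b[%classic x -> (0 <= (f x)%:E)%E.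
  by rewrite /= in_itv /= lee_fin => /fg/andP[].
have g0 x : `]a, b[%classic x -> (0 <= (g x)%:E)%E.
  by rewrite /= in_itv /= lee_fin => /fg/andP[]; exact: le_trans.
have le : (\int[@lebesgue_measure R]_(x in `]a, b[) (f x)%:E <=
    \int[@lebesgue_measure R]_(x in `]a, b[) (g x)%:E)%E.
  rewrite !ge0_integralE//; apply: ge_ereal_sup => _ [h /= hf <-].
  apply: ereal_sup_ubound; exists h => //= x.
  apply: (le_trans (hf x)); rewrite /patch; case: ifPn => //.
  by rewrite inE /= in_itv /= lee_fin => /fg/andP[].
rewrite /Rintegral; apply/andP; split.
  by apply: fine_ge0; exact: integral_ge0.
have g_fin : (\int[@lebesgue_measure R]_(x in `]a, b[) (g x)%:E)%E \is a fin_num.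
  by apply: integrable_fin_num => //; exact: measurable_itv.
apply: fine_le => //.
rewrite ge0_fin_numE; last exact: integral_ge0.
apply: (le_lt_trans le); rewrite -ge0_fin_numE//; exact: integral_ge0.
Qed.

Lemma has_int_nil (R : realType) (a : R) f v : has_int a a f v -> v = 0.
Proof. by move=> [_ <-]; rewrite set_itv_ge ?bnd_simp ?ltxx// Rintegral_set0. Qed.

Lemma has_int_empty (R : realType) (a : R) f : has_int a a f 0.
Proof.
split; rewrite set_itv_ge ?bnd_simp ?ltxx// ?Rintegral_set0//.
exact: integrable_set0.
Qed.

Lemma integrable_setU (d : measure_display) (T : measurableType d) (R : realType)
    (mu : {measure set T -> \bar R}) (A B : set T) (f : T -> R) :
  measurable A -> measurable B -> [disjoint A & B] ->
  mu.-integrable A (EFin \o f) -> mu.-integrable B (EFin \o f) ->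
  mu.-integrable (A `|` B) (EFin \o f).
Proof.
move=> mA mB /disj_setPRL dAB iA iB.
apply/integrable_mkcond; first exact: measurableU.
move/(integrable_mkcond _ mA) : iA => iA; move/(integrable_mkcond _ mB) : iB => iB.
have := integrableD measurableT iA iB.
apply: eq_integrable => // x _; rewrite /= /patch.
have [xA|xA] := boolP (x \in A); have [xB|xB] := boolP (x \in B).
- by move: (xA) (xB); rewrite !inE => xA' xB'; have := dAB _ xB'.
- by rewrite (_ : x \in A `|` B) ?adde0// inE; left; rewrite inE in xA.
- by rewrite (_ : x \in A `|` B) ?add0e// inE; right; rewrite inE in xB.
- rewrite (_ : (x \in A `|` B) = false) ?adde0//.
  by apply/negP; rewrite inE => -[] /mem_set; apply/negP.
Qed.

Lemma integrable_set1 (R : realType) (f : R -> R) (a : R) :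
  (@lebesgue_measure R).-integrable [set a] (EFin \o f).
Proof.
apply/integrableP; split; first exact: measurable_fun_set1.
by rewrite integral_set1.
Qed.

Lemma has_int_cc (R : realType) (a b : R) f v : a < b -> has_int a b f v ->
  (@lebesgue_measure R).-integrable `[a, b] (EFin \o f) /\
  \int[@lebesgue_measure R]_(x in `[a, b]) f x = v.
Proof.
move=> ab [If <-].
have Ico : (@lebesgue_measure R).-integrable `[a, b[ (EFin \o f).
  rewrite -(@setU1itv _ _ _ _ false) ?bnd_simp//; apply: integrable_setU => //.
    by apply/disj_setPRL => x /=; rewrite in_itv/= => /andP[ax _] xa; rewrite xa ltxx in ax.
  exact: integrable_set1.
split.
  rewrite -(@setUitv1 _ _ _ _ true) ?bnd_simp ?(ltW ab)//; apply: integrable_setU => //.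
    by apply/disj_setPLR => x /=; rewrite in_itv/= => /andP[_ xb] xa; rewrite xa ltxx in xb.
  exact: integrable_set1.
by rewrite -Rintegral_itv_bndo_bndc// -Rintegral_itv_obnd_cbnd.
Qed.

Lemma has_int_cat (R : realType) (a b c : R) f v w : a <= b <= c ->
  has_int a b f v -> has_int b c f w -> has_int a c f (v + w).
Proof.
move=> /andP[ab bc] fv fw.
have [ab'|ba] := ltP a b; last first.
  have e := le_anti (introT andP (conj ab ba)); subst b.
  by rewrite (has_int_nil fv) add0r.
have [bc'|cb] := ltP b c; last first.
  have e := le_anti (introT andP (conj bc cb)); subst b.
  by rewrite (has_int_nil fw) addr0.
have E : `]a, c[%classic = `]a, b] `|` `]b, c[ :> set R.
  by rewrite -itv_bndbnd_setU// bnd_simp.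
have dj : [disjoint `]a, b]%classic & (`]b, c[%classic : set R)].
  apply/disj_setPRL => x /=; rewrite !in_itv/= => /andP[bx _] /andP[_ xb].
  by have := lt_le_trans bx xb; rewrite ltxx.
case: fv => Iv <-; case: fw => Iw <-.
have Ioc : (@lebesgue_measure R).-integrable `]a, b] (EFin \o f).
  rewrite -(@setUitv1 _ _ _ _ true) ?bnd_simp//; apply: integrable_setU => //.
    by apply/disj_setPLR => x /=; rewrite in_itv/= => /andP[_ xb] xa; rewrite xa ltxx in xb.
  exact: integrable_set1.
have Iac : (@lebesgue_measure R).-integrable `]a, c[ (EFin \o f).
  by rewrite E; apply: integrable_setU.
split => //.
by rewrite {1}E Rintegral_setU// -?E// -Rintegral_itv_bndo_bndc.
Qed.

(** * The one-dimensional representation and its covariance *)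

Definition c1_on (R : realType) (a b : R) (f f' : R -> R) : Prop :=
  [/\ {within `[a, b], continuous f}, {within `[a, b], continuous f'} &
      forall x, a < x < b -> is_derive x (1 : R) f (f' x)].

Lemma c1_on_sub (R : realType) (a b c d : R) (f f' : R -> R) :
  a <= c -> d <= b -> c1_on a b f f' -> c1_on c d f f'.
Proof.
move=> ac db [cf cf' df].
have sub : (`[c, d] `<=` (`[a, b] : set R))%classic.
  by apply: subset_itv; rewrite bnd_simp.
split; [exact: continuous_subspaceW cf|exact: continuous_subspaceW cf'|].
by move=> x /andP[cx xd]; apply: df; rewrite (le_lt_trans ac cx) (lt_le_trans xd db).
Qed.

Lemma has_int_continuous (R : realType) (a b : R) (f : R -> R) :
  {within `[a, b], continuous f} ->
  has_int a b f (\int[@lebesgue_measure R]_(x in `]a, b[) f x).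
Proof.
move=> cf; split => //.
have cI : (@lebesgue_measure R).-integrable `[a, b] (EFin \o f).
  by apply: continuous_compact_integrable; [exact: segment_compact|].
by apply: integrableS cI => //; exact: subset_itv_oo_cc.
Qed.

Lemma has_int_FTC (R : realType) (a b : R) (f f' : R -> R) : a <= b ->
  c1_on a b f f' -> has_int a b f' (f b - f a).
Proof.
rewrite le_eqVlt => /orP[/eqP<- _|ab [cf cf' df]].
  by rewrite subrr; exact: has_int_empty.
have hi := has_int_continuous cf'.
suff <- : \int[@lebesgue_measure R]_(x in `]a, b[) f' x = f b - f a by [].
have [_ <-] := has_int_cc ab hi.
rewrite /Rintegral (@continuous_FTC2 R f' f a b ab cf')//.
  have [cx ca cb] := (continuous_within_itvP f ab).1 cf; split => //.
  by move=> x; rewrite in_itv /= => /df[].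
move=> x; rewrite in_itv /= => /df dx; rewrite derive1E; exact: derive_val.
Qed.

Lemma has_int_pow (R : realType) (a b : R) n : a <= b ->
  has_int a b (fun t => t ^+ n) ((b ^+ n.+1 - a ^+ n.+1) / n.+1%:R).
Proof.
move=> ab.
have pd k (x : R) : is_derive x (1 : R) (fun t : R => t ^+ k.+1) (k.+1%:R * x ^+ k).
  have h := is_deriveX k.+1 (is_derive_id x (1 : R)).
  rewrite exprfctE in h.
  by refine (@is_derive_eq _ _ _ _ _ _ _ _ h _); rewrite /= /GRing.scale /= mulr1.
have cts k : continuous (fun t : R => t ^+ k) by move=> x; exact: exprn_continuous.
have h : has_int a b (fun t => n.+1%:R * t ^+ n) (b ^+ n.+1 - a ^+ n.+1).
  apply: (@has_int_FTC _ _ _ (fun t => t ^+ n.+1)) => //; split.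
  - exact: continuous_subspaceT.
  - by apply: continuous_subspaceT => x; apply: cvgMr; exact: cts.
  - by move=> x _; exact: pd.
apply: has_int_eq (has_intZ n.+1%:R^-1 h) => [x _|]; last by rewrite mulrC.
by rewrite mulKf// pnatr_eq0.
Qed.

Lemma has_int_quad (R : realType) (a b A B C : R) : a <= b ->
  has_int a b (fun t => A * t ^+ 2 + B * t + C)
    (A * ((b ^+ 3 - a ^+ 3) / 3) + B * ((b ^+ 2 - a ^+ 2) / 2) + C * (b - a)).
Proof.
move=> ab.
have h1 := has_intZ B (has_int_pow 1 ab).
have h2 := has_intZ A (has_int_pow 2 ab).
exact: has_intD (has_intD h2 h1) (has_int_cst C ab).
Qed.

Lemma has_int_quad_eq (R : realType) (a b A B C : R) (f : R -> R) : a <= b ->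
  (forall t, a < t < b -> A * t ^+ 2 + B * t + C = f t) ->
  has_int a b f
    (A * ((b ^+ 3 - a ^+ 3) / 3) + B * ((b ^+ 2 - a ^+ 2) / 2) + C * (b - a)).
Proof. by move=> ab fE; apply: has_int_eq (has_int_quad A B C ab). Qed.

(** The kernel that recovers [f x] from the mean of [f] and from [f']. *)
Definition anova_kernel (R : realType) (x t : R) : R := t + 2^-1 - (x < t)%R%:R.

(** With [X = x + 1/2] and [Y = y + 1/2] in [0, 1], this is
    [B2 |X - Y| / 2 + (X - 1/2) (Y - 1/2)]. *)
Definition anova_cov (R : realType) (x y : R) : R :=
  3^-1 + ((x + 2^-1) ^+ 2 + (y + 2^-1) ^+ 2) / 2 - (Num.max x y + 2^-1).

Lemma anova_cov_sym (R : realType) (x y : R) : anova_cov x y = anova_cov y x.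
Proof. by rewrite /anova_cov maxC [_ ^+ 2 + _]addrC. Qed.

Lemma has_int_kernel_mul (R : realType) (x y : R) : Y x -> Y y ->
  has_int (- 2^-1) 2^-1 (fun t => anova_kernel x t * anova_kernel y t)
    (anova_cov x y).
Proof.
wlog xy : x y / x <= y.
  move=> h Yx Yy; have [xy|/ltW yx] := leP x y; first exact: h.
  by rewrite anova_cov_sym; apply: has_int_eq (h y x yx Yy Yx) => // t _; rewrite mulrC.
rewrite /Y /= !in_itv /= => /andP[x1 x2] /andP[y1 y2].
set f := fun t : R => _.
have leftE t : - 2^-1 < t < x -> 1 * t ^+ 2 + 1 * t + 4^-1 = f t.
  move=> /andP[_ tx]; rewrite /f /anova_kernel !ltNge (ltW tx).
  by rewrite (le_trans (ltW tx) xy) /=; field.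
have midE t : x < t < y -> 1 * t ^+ 2 + 0 * t + (- 4^-1) = f t.
  by move=> /andP[xt ty]; rewrite /f /anova_kernel xt ltNge (ltW ty) /=; field.
have rightE t : y < t < 2^-1 -> 1 * t ^+ 2 + (-1) * t + 4^-1 = f t.
  by move=> /andP[yt _]; rewrite /f /anova_kernel (le_lt_trans xy yt) yt /=; field.
have left := has_int_quad_eq x1 leftE.
have mid := has_int_quad_eq xy midE.
have right := has_int_quad_eq y2 rightE.
have h := has_int_cat (introT andP (conj x1 (le_trans xy y2)))
  left (has_int_cat (introT andP (conj xy y2)) mid right).
by apply: has_int_eq h => //; rewrite /anova_cov max_r//; field.
Qed.

Lemma within_mul_affine (R : realType) (A : set R) (f : R -> R) c :
  {within A, continuous f} -> {within A, continuous (fun t => f t * (t + c))}.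
Proof.
move=> cf x; apply: cvgM; first exact: cf.
have : {within A, continuous (fun t : R => t + c)}.
  by apply: continuous_subspaceT => t; apply: cvgD; [exact: cvg_id|exact: cvg_cst].
exact.
Qed.

Lemma c1_on_mul_affine (R : realType) (a b c : R) (f f' : R -> R) :
  c1_on a b f f' -> c1_on a b (fun t => f t * (t + c)) (fun t => f t + f' t * (t + c)).
Proof.
move=> [cf cf' df]; split.
- exact: within_mul_affine.
- by move=> x; apply: cvgD; [exact: cf|exact: within_mul_affine].
- move=> x /df dx.
  have d2 : is_derive x (1 : R) ((@id R) + cst c) (1 + 0) by exact: is_deriveD.
  have h := is_deriveM dx d2; refine (@is_derive_eq _ _ _ _ _ _ _ _ h _).
  by rewrite /= /GRing.scale /= addr0 mulr1 mulrC.
Qed.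

(** On each side of [x] the integrand is the derivative of a product
    [f t * (t +- 1/2)], whose outer boundary terms vanish. *)
Lemma has_int_anova (R : realType) (f f' : R -> R) (x : R) : Y x ->
  c1_on (- 2^-1) 2^-1 f f' ->
  has_int (- 2^-1) 2^-1 (fun t => f t + f' t * anova_kernel x t) (f x).
Proof.
rewrite /Y /= in_itv /= => /andP[x1 x2] fc.
have left := has_int_FTC x1 (c1_on_mul_affine 2^-1 (c1_on_sub (lexx _) x2 fc)).
have right := has_int_FTC x2 (c1_on_mul_affine (- 2^-1) (c1_on_sub x1 (lexx _) fc)).
have left' : has_int (- 2^-1) x (fun t => f t + f' t * anova_kernel x t)
    (f x * (x + 2^-1)).
  apply: has_int_eq left => [t /andP[_ tx]|]; last by ring.
  by rewrite /anova_kernel ltNge (ltW tx) /= subr0.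
have right' : has_int x 2^-1 (fun t => f t + f' t * anova_kernel x t)
    (- f x * (x - 2^-1)).
  apply: has_int_eq right => [t /andP[xt _]|]; last by ring.
  by rewrite /anova_kernel xt /=; congr (_ + _ * _); lra.
have h := has_int_cat (introT andP (conj x1 x2)) left' right'.
by apply: has_int_eq h => //; field.
Qed.

Lemma frac_part_ge0_lt1 (R : realType) (x : R) : 0 <= frac_part x < 1.
Proof.
rewrite /frac_part subr_ge0 ge_floor /= ltrBlDl.
by have := floorD1_gt x; rewrite intrD.
Qed.

Lemma frac_part_add_int (R : realType) (x : R) (k : int) :
  frac_part (x + k%:~R) = frac_part x.
Proof.
have := floor_itv x => /andP[h1 h2].
rewrite /frac_part (@floor_def _ _ (Num.floor x + k)); first by rewrite intrD; ring.
by move: h1 h2; rewrite !intrD; lra.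
Qed.

Lemma frac_part_eq (R : realType) (x y : R) (k : int) :
  x = y + k%:~R -> 0 <= y < 1 -> frac_part x = y.
Proof.
by move=> -> y01; rewrite frac_part_add_int /frac_part (@floor_def _ _ 0) ?subr0.
Qed.

Lemma B2_reflect (R : realType) (t : R) : B2 (1 - t) = B2 t.
Proof. by rewrite /B2; ring. Qed.

(** The fractional parts wrap around at [D = 1 - a] and at [D = 1 - b]; between
    these points the integrand is a quadratic polynomial. *)
Lemma has_int_shift_cov01 (R : realType) (a b : R) : 0 <= b -> b <= a -> a < 1 ->
  has_int 0 1 (fun D => anova_cov (frac_part (a + D) - 2^-1)
                                  (frac_part (b + D) - 2^-1)) (B2 (a - b)).
Proof.
move=> b0 ba a1.
have frac0 (c D : R) : 0 <= c + D < 1 -> frac_part (c + D) = c + D.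
  by move=> h; apply: (@frac_part_eq _ _ _ 0) => //; rewrite addr0.
have frac1 (c D : R) : 1 <= c + D < 2 -> frac_part (c + D) = c + D - 1.
  by move=> h; apply: (@frac_part_eq _ _ _ 1); rewrite ?subrK//; lra.
have p1 : 0 <= 1 - a by lra.
have p2 : 1 - a <= 1 - b by lra.
have p3 : 1 - b <= 1 by lra.
set f := fun D : R => _.
have leftE D : 0 < D < 1 - a ->
    1 * D ^+ 2 + (a + b - 1) * D + (3^-1 + (a ^+ 2 + b ^+ 2) / 2 - a) = f D.
  by move=> h; rewrite /f !frac0 /anova_cov ?max_l; [field|lra..].
have midE D : 1 - a < D < 1 - b ->
    1 * D ^+ 2 + (a + b - 2) * D + (3^-1 + ((a - 1) ^+ 2 + b ^+ 2) / 2 - b) = f D.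
  by move=> h; rewrite /f frac1 ?frac0 /anova_cov ?max_r; [field|lra..].
have rightE D : 1 - b < D < 1 ->
    1 * D ^+ 2 + (a + b - 3) * D +
    (3^-1 + ((a - 1) ^+ 2 + (b - 1) ^+ 2) / 2 - (a - 1)) = f D.
  by move=> h; rewrite /f !frac1 /anova_cov ?max_l; [field|lra..].
have left := has_int_quad_eq p1 leftE.
have mid := has_int_quad_eq p2 midE.
have right := has_int_quad_eq p3 rightE.
have h := has_int_cat (introT andP (conj p1 (le_trans p2 p3)))
  left (has_int_cat (introT andP (conj p2 p3)) mid right).
by apply: has_int_eq h => //; rewrite /B2; field.
Qed.

Lemma has_int_shift_cov (R : realType) (a b : R) :
  has_int 0 1 (fun D => anova_cov (frac_part (a + D) - 2^-1)
                                  (frac_part (b + D) - 2^-1)) (B2 (frac_part (a - b))).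
Proof.
have fracE (x : R) : x = frac_part x + (Num.floor x)%:~R by rewrite /frac_part subrK.
have shift (x D : R) : frac_part (x + D) = frac_part (frac_part x + D).
  by rewrite {1}(fracE x) addrAC frac_part_add_int.
have ordered (x y : R) : frac_part y <= frac_part x ->
    has_int 0 1 (fun D => anova_cov (frac_part (x + D) - 2^-1)
      (frac_part (y + D) - 2^-1)) (B2 (frac_part x - frac_part y)).
  move=> yx; have /andP[y0 _] := frac_part_ge0_lt1 y.
  have /andP[_ x1] := frac_part_ge0_lt1 x.
  apply: has_int_eq (has_int_shift_cov01 y0 yx x1) => // D _.
  by rewrite -!shift.
have /andP[a0 a1] := frac_part_ge0_lt1 a; have /andP[b0 b1] := frac_part_ge0_lt1 b.
have diffE : a - b = (frac_part a - frac_part b) + (Num.floor a - Num.floor b)%:~R.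
  by rewrite rmorphB /= {1}(fracE a) {1}(fracE b); ring.
rewrite diffE frac_part_add_int.
have [ba|ab] := leP (frac_part b) (frac_part a).
  rewrite (@frac_part_eq _ (frac_part a - frac_part b) (frac_part a - frac_part b) 0).
  - exact: ordered.
  - by rewrite addr0.
  - lra.
rewrite (@frac_part_eq _ _ (1 - (frac_part b - frac_part a)) (-1)); last 2 first.
- by rewrite rmorphN /=; ring.
- lra.
rewrite B2_reflect; apply: has_int_eq (ordered _ _ (ltW ab)) => // D _.
by rewrite anova_cov_sym.
Qed.

(** * Functionals of functions with bounded mixed derivatives *)

Definition in_cube (R : realType) (s : nat) (y : s.-tuple R) : Prop :=
  forall x, x \in (y : seq R) -> Y x.

Lemma in_cube_cons (R : realType) s (t : R) (y : s.-tuple R) :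
  Y t -> in_cube y -> in_cube (cons_tuple t y).
Proof. by move=> Yt Yy x; rewrite inE => /orP[/eqP->|/Yy]. Qed.

(** The space of functions with dominating mixed smoothness of order one, with
    radius [M] in the sup norm.  The recursion on the dimension follows the order
    in which the coordinates are expanded, so that mixed derivatives only occur
    in that order. *)
Fixpoint mixed_c1 (R : realType) (M : R) (s : nat) : (s.-tuple R -> R) -> Prop :=
  match s with
  | 0 => fun f => `|f (nil_tuple R)| <= M
  | s'.+1 => fun f => exists f' : R -> s'.-tuple R -> R,
      [/\ forall t, Y t -> mixed_c1 M (fun y : s'.-tuple R => f (cons_tuple t y)),
          forall t, Y t -> mixed_c1 M (f' t) &
          forall y, in_cube y ->
            c1_on (- 2^-1) 2^-1 (fun t => f (cons_tuple t y)) (fun t => f' t y)]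
  end.

Lemma mixed_c1_le (R : realType) (M N : R) s (f : s.-tuple R -> R) :
  M <= N -> mixed_c1 M f -> mixed_c1 N f.
Proof.
move=> MN; elim: s f => [|s IH] f /=; first by move/le_trans; apply.
by move=> [f' [h1 h2 h3]]; exists f'; split => // t Yt; apply: IH; auto.
Qed.

Lemma mixed_c1_bounded (R : realType) (M : R) s (f : s.-tuple R -> R) y :
  mixed_c1 M f -> in_cube y -> `|f y| <= M.
Proof.
elim: s f y => [|s IH] f y /=; first by rewrite [y]tuple0.
case/tupleP: y => t y [f' [h1 _ _]] Yty.
apply: (IH (fun y => f (cons_tuple t y))); first by apply: h1; apply: Yty; rewrite inE eqxx.
by move=> x xy; apply: Yty; rewrite inE xy orbT.
Qed.

Lemma c1_on_lipschitz (R : realType) (a b M : R) (f f' : R -> R) :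
  c1_on a b f f' -> (forall t, a <= t <= b -> `|f' t| <= M) ->
  forall t u, a <= t <= b -> a <= u <= b -> `|f t - f u| <= M * `|t - u|.
Proof.
move=> fc f'M t u.
wlog tu : t u / t <= u.
  move=> h ht hu; have [tu|/ltW ut] := leP t u; first exact: h.
  by rewrite distrC [X in _ <= _ * X]distrC; exact: h.
move=> /andP[at_ tb] /andP[au ub].
have [cf _ df] := c1_on_sub at_ ub fc.
have [x xtu fE] : exists2 x, x \in `[t, u] & f u - f t = f' x * (u - t).
  by apply: MVT_segment => // x; rewrite in_itv/= => /df.
rewrite distrC fE normrM [X in _ <= _ * X]distrC ler_wpM2r// f'M//.
move: xtu; rewrite in_itv/= => /andP[tx xu].
by rewrite (le_trans at_ tx) (le_trans xu ub).
Qed.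

Lemma lipschitz_within_continuous (R : realType) (a b M : R) (f : R -> R) :
  (forall t u, a <= t <= b -> a <= u <= b -> `|f t - f u| <= M * `|t - u|) ->
  {within `[a, b], continuous f}.
Proof.
move=> fM; apply/subspace_continuousP => x /=; rewrite in_itv /= => xab.
apply/cvgrPdist_le => e e0; rewrite near_withinE.
near=> t => /=; rewrite in_itv /= => tab.
apply: (le_trans (fM _ _ xab tab)).
have M1 : 0 < `|M| + 1 by rewrite ltr_wpDl.
have : `|x - t| <= e / (`|M| + 1).
  by near: t; apply: (@cvgr_dist_le _ _ _ (nbhs x) _ id x); [exact: cvg_id|exact: divr_gt0].
move=> h; apply: (le_trans (y := (`|M| + 1) * `|x - t|)).
  by rewrite ler_wpM2r// (le_trans (ler_norm M))// lerDl.
by rewrite -ler_pdivlMl// mulrC.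
Unshelve. all: by end_near. Qed.

Lemma Y_itv (R : realType) (t : R) : Y t = (- 2^-1 <= t <= 2^-1) :> Prop.
Proof. by rewrite /Y /= in_itv. Qed.

Lemma mixed_c1_lipschitz (R : realType) (M : R) s (f : s.+1.-tuple R -> R) y t u :
  mixed_c1 M f -> in_cube y -> Y t -> Y u ->
  `|f (cons_tuple t y) - f (cons_tuple u y)| <= M * `|t - u|.
Proof.
move=> /= [f' [_ h2 h3]] Yy; rewrite !Y_itv => Yt Yu.
apply: (c1_on_lipschitz (h3 y Yy)) => // v; rewrite -Y_itv => Yv.
exact: mixed_c1_bounded (h2 v Yv) Yy.
Qed.

Lemma mhalf_lt_half (R : realType) : - 2^-1 < 2^-1 :> R.
Proof. by rewrite -subr_gt0 opprK addr_gt0 ?invr_gt0. Qed.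

(** Stability of the inner integral makes it a Lipschitz function of the outer
    variable, hence an integrable one. *)
Lemma has_int_slice_of_close (R : realType) s :
  (forall (M N e : R) (f g : s.-tuple R -> R), mixed_c1 M f -> mixed_c1 N g ->
    (forall y, in_cube y -> `|f y - g y| <= e) ->
    `|cube_integral (@Y R) f - cube_integral (@Y R) g| <= e) ->
  forall (M : R) (f : s.+1.-tuple R -> R), mixed_c1 M f ->
  has_int (- 2^-1) 2^-1
    (fun t => cube_integral (@Y R) (fun y : s.-tuple R => f (cons_tuple t y)))
    (cube_integral (@Y R) f).
Proof.
move=> close M f fM.
pose F t := cube_integral (@Y R) (fun y : s.-tuple R => f (cons_tuple t y)).
have cF : {within `[- 2^-1, 2^-1], continuous F}.
  apply: (@lipschitz_within_continuous _ _ _ M) => t u; rewrite -!Y_itv => Yt Yu.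
  case: (fM) => f' [h1 _ _].
  apply: (close _ _ _ _ _ (h1 t Yt) (h1 u Yu)) => y Yy.
  exact: mixed_c1_lipschitz.
have h := has_int_continuous cF.
have [_ hE] := has_int_cc (mhalf_lt_half R) h.
apply: has_int_eq h => //.
Qed.

Lemma cube_integral_close (R : realType) s (M N e : R) (f g : s.-tuple R -> R) :
  mixed_c1 M f -> mixed_c1 N g -> (forall y, in_cube y -> `|f y - g y| <= e) ->
  `|cube_integral (@Y R) f - cube_integral (@Y R) g| <= e.
Proof.
elim: s M N e f g => [|s IH] M N e f g fM gN fg; first by apply: fg => x.
have If := has_int_slice_of_close IH fM.
have Ig := has_int_slice_of_close IH gN.
have Ie := has_int_cst e (ltW (mhalf_lt_half R)).
have fg' t : - 2^-1 < t < 2^-1 ->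
    `|cube_integral (@Y R) (fun y : s.-tuple R => f (cons_tuple t y)) -
      cube_integral (@Y R) (fun y : s.-tuple R => g (cons_tuple t y))| <= e.
  move=> /andP[t1 t2]; have Yt : Y t by rewrite Y_itv !ltW.
  case: fM => f' [hf _ _]; case: gN => g' [hg _ _].
  apply: (IH _ _ _ _ _ (hf t Yt) (hg t Yt)) => y Yy.
  exact/fg/in_cube_cons.
have e1 : e * (2^-1 - - 2^-1) = e by field.
rewrite e1 in Ie; rewrite ler_distl; apply/andP; split.
  rewrite lerBlDr; apply: has_int_le Ig (has_intD If Ie) => t /fg'.
  by rewrite ler_distl => /andP[]; lra.
apply: has_int_le If (has_intD Ig Ie) => t /fg'.
by rewrite ler_distl => /andP[].
Qed.

Lemma has_int_slice (R : realType) s (M : R) (f : s.+1.-tuple R -> R) :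
  mixed_c1 M f ->
  has_int (- 2^-1) 2^-1
    (fun t => cube_integral (@Y R) (fun y : s.-tuple R => f (cons_tuple t y)))
    (cube_integral (@Y R) f).
Proof. by apply: has_int_slice_of_close; exact: cube_integral_close. Qed.

Definition cov_prod (R : realType) (s : nat) (x y : s.-tuple R) : R :=
  \prod_(j < s) (1 + anova_cov (tnth x j) (tnth y j)).

Lemma cov_prod_cons (R : realType) s (t u : R) (x y : s.-tuple R) :
  cov_prod (cons_tuple t x) (cons_tuple u y) = (1 + anova_cov t u) * cov_prod x y.
Proof.
rewrite /cov_prod big_ord_recl !tnth0; congr (_ * _).
by apply: eq_bigr => j _; rewrite !tnthS.
Qed.

(** In the induction step the functional is the integral over [u] of [A u + C u].
    Here [A u] is the same functional applied to the slice of [f] at [u], and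
    [C u] is a sum of values of the derivative slice, weighted by
    [a_i k(t_i, u)]; both are covered by the induction hypothesis.  Integrating
    [k(t_i, u) k(t_l, u)] produces the new factor of the matrix. *)
Lemma functional_sq_le (R : realType) (M : R) s (f : s.-tuple R -> R)
    (I : Type) (r : seq I) (a : I -> R) (x : I -> s.-tuple R) (c : R) :
  mixed_c1 M f -> (forall i, in_cube (x i)) ->
  (c * cube_integral (@Y R) f + \sum_(i <- r) a i * f (x i)) ^+ 2 <=
  2 ^+ s * M ^+ 2 * (c ^+ 2 + 2 * c * (\sum_(i <- r) a i) +
    \sum_(i <- r) \sum_(k <- r) a i * a k * cov_prod (x i) (x k)).
Proof.
elim: s f a x c => [|s IH] f a x c fM Yx.
  rewrite /= in fM *.
  have fx i : f (x i) = f (nil_tuple R) by rewrite [x i]tuple0.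
  under eq_bigr => i _ do rewrite fx.
  rewrite -mulr_suml -mulrDl exprMn mulrC expr0 mul1r.
  set A := \sum_(i <- r) a i.
  have -> : \sum_(i <- r) \sum_(k <- r) a i * a k * cov_prod (x i) (x k) = A * A.
    rewrite /A mulr_suml; apply: eq_bigr => i _; rewrite mulr_sumr.
    by apply: eq_bigr => k _; rewrite /cov_prod big_ord0 mulr1.
  have -> : c ^+ 2 + 2 * c * A + A * A = (c + A) ^+ 2 by ring.
  rewrite ler_wpM2r ?sqr_ge0// -real_normK ?num_real// ler_pXn2r ?nnegrE//.
  exact: le_trans fM.
pose t i := thead (x i); pose y i := behead_tuple (x i).
have xE i : x i = cons_tuple (t i) (y i).
  by rewrite {1}(tuple_eta (x i)); apply: val_inj.
have Yt i : Y (t i) by apply: (Yx i); rewrite xE inE eqxx.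
have Yy i : in_cube (y i) by move=> u uy; apply: (Yx i); rewrite xE inE uy orbT.
have Is := has_int_slice fM.
case: (fM) => f' [h1 h2 h3].
set T := c * cube_integral (@Y R) f + _.
have IT : has_int (- 2^-1) 2^-1 (fun u =>
    c * cube_integral (@Y R) (fun y : s.-tuple R => f (cons_tuple u y)) +
    \sum_(i <- r) a i * (f (cons_tuple u (y i)) + f' u (y i) * anova_kernel (t i) u)) T.
  apply: has_intD; first exact: has_intZ.
  apply: has_int_sum; first exact/ltW/mhalf_lt_half.
  move=> i; apply: has_intZ; rewrite xE; exact: (has_int_anova (Yt i) (h3 _ (Yy i))).
pose B := 2 ^+ s * M ^+ 2.
pose q u := \sum_(i <- r) \sum_(k <- r)
  a i * a k * cov_prod (y i) (y k) * (anova_kernel (t i) u * anova_kernel (t k) u).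
pose E := \sum_(i <- r) \sum_(k <- r)
    a i * a k * cov_prod (y i) (y k) * anova_cov (t i) (t k).
have Iq : has_int (- 2^-1) 2^-1 q E.
  have hh : - 2^-1 <= 2^-1 :> R := ltW (mhalf_lt_half R).
  apply: has_int_sum => // i; apply: has_int_sum => // k.
  by apply: has_intZ; exact: has_int_kernel_mul.
pose Q := c ^+ 2 + 2 * c * (\sum_(i <- r) a i) +
  \sum_(i <- r) \sum_(k <- r) a i * a k * cov_prod (y i) (y k).
(* the bound 2 T h <= T^2 + h^2 for h = A u + C u, to be integrated in u *)
have IQ := has_intD (has_int_cst (T ^+ 2 + 2 * B * Q) (ltW (mhalf_lt_half R)))
  (has_intZ (2 * B) Iq).
have := has_int_le _ (has_intZ (2 * T) IT) IQ.
have sumE : c ^+ 2 + 2 * c * (\sum_(i <- r) a i) +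
    \sum_(i <- r) \sum_(k <- r) a i * a k * cov_prod (x i) (x k) =
  Q + E.
  rewrite /Q /E -[RHS]addrA -big_split /=; congr (_ + _); apply: eq_bigr => i _.
  rewrite -big_split /=; apply: eq_bigr => k _.
  by rewrite {1}(xE i) {1}(xE k) cov_prod_cons; ring.
rewrite sumE (exprS 2 s) => h.
suff : 2 * T * T <= (T ^+ 2 + 2 * B * Q) * (2^-1 - - 2^-1) +
    2 * B * E.
  have -> : (T ^+ 2 + 2 * B * Q) * (2^-1 - - 2^-1) = T ^+ 2 + 2 * B * Q by field.
  have -> : 2 * 2 ^+ s * M ^+ 2 = 2 * B by rewrite /B mulrA.
  by move: (B) (Q) (E) (T) => B' Q' E' T'; lra.
apply: h => u /andP[u1 u2]; have Yu : Y u by rewrite Y_itv !ltW.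
have bA := IH _ a y c (h1 u Yu) Yy.
have bB := IH _ (fun i => a i * anova_kernel (t i) u) y 0 (h2 u Yu) Yy.
rewrite !(expr0n, mul0r, mulr0, add0r) /= -/B in bB.
have qE : \sum_(i <- r) \sum_(k <- r) a i * anova_kernel (t i) u *
    (a k * anova_kernel (t k) u) * cov_prod (y i) (y k) = q u.
  by apply: eq_bigr => i _; apply: eq_bigr => k _; ring.
rewrite qE in bB; rewrite -/B -/Q in bA.
set A := c * _ + _ in bA; set C := \sum_(i <- r) _ in bB.
have -> : c * cube_integral (@Y R) (fun y : s.-tuple R => f (cons_tuple u y)) +
  \sum_(i <- r) a i * (f (cons_tuple u (y i)) + f' u (y i) * anova_kernel (t i) u)
  = A + C.
  rewrite /A /C -addrA -big_split /=; congr (_ + _); apply: eq_bigr => i _; ring.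
have := sqr_ge0 (T - (A + C)); have := sqr_ge0 (A - C); lra.
Qed.

(** A sum of products of functions of single variables dominates [f], and its
    iterated integral factors. *)
Lemma shift_expectation_le (R : realType) s (I : Type) (r : seq I) (w : I -> R)
    (g : I -> nat -> R -> R) (v : I -> nat -> R) (c : R) (f : s.-tuple R -> R) :
  (forall i j, has_int 0 1 (g i j) (v i j)) ->
  (forall D : s.-tuple R, (forall x, x \in (D : seq R) -> 0 < x < 1) ->
    0 <= f D <= c + \sum_(i <- r) w i * \prod_(0 <= j < s) g i j (nth 0 D j)) ->
  0 <= shift_expectation f <= c + \sum_(i <- r) w i * \prod_(0 <= j < s) v i j.
Proof.
rewrite /shift_expectation; elim: s w g v f => [|s IH] w g v f gv fb /=.
  have := fb (nil_tuple R) (fun x => ltac:(by [])).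
  by rewrite (eq_bigr (fun i => w i * \prod_(0 <= j < 0) v i j))// => i _; rewrite !big_geq.
apply: (@Rintegral_le_dom _ _ _ _ (fun t => c +
    \sum_(i <- r) w i * g i 0%N t * \prod_(0 <= j < s) v i j.+1)) => [t t01|].
  apply: (IH (fun i => w i * g i 0%N t) (fun i j => g i j.+1) (fun i j => v i j.+1)) => //.
  move=> D D01; have := fb (cons_tuple t D).
  rewrite (eq_bigr (fun i => w i * g i 0%N t * \prod_(0 <= j < s) g i j.+1 (nth 0 D j))).
    by apply=> x; rewrite inE => /orP[/eqP->|/D01].
  by move=> i _; rewrite big_nat_recl//= mulrA.
apply: has_int_eq (has_intD (has_int_cst c ler01) (has_int_sum r ler01
    (fun i => has_intZ (w i * \prod_(0 <= j < s) v i j.+1) (gv i 0%N)))) => [t _|].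
  by congr (_ + _); apply: eq_bigr => i _; ring.
rewrite subr0 mulr1; congr (_ + _); apply: eq_bigr => i _.
by rewrite big_nat_recl//=; ring.
Qed.

(** * Smooth functions have bounded mixed derivatives *)

Definition glue (R : realType) (r : nat) (x : nat -> R) (y : seq R) : nat -> R :=
  fun j => if (j < r)%N then x j else nth 0 y (j - r).

Lemma glue_cons (R : realType) r (x : nat -> R) t (y : seq R) :
  glue r x (t :: y) = glue r.+1 [eta x with r |-> t] y.
Proof.
apply/funext => j; rewrite /glue /= ltnS.
have [jr|rj|->] := ltngtP j r; [by []| |by rewrite subnn].
by rewrite -[(j - r)%N](@prednK _) ?subn_gt0//= subnS.
Qed.

Lemma glue_set (R : realType) r (x : nat -> R) t (y : seq R) :
  glue r.+1 [eta x with r |-> t] y = [eta glue r.+1 x y with r |-> t].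
Proof.
apply/funext => j; rewrite /glue /= ltnS.
by have [->|jr] := eqVneq j r; rewrite ?leqnn.
Qed.

Lemma Y0 (R : realType) : Y (0 : R).
Proof. by rewrite Y_itv; have := mhalf_lt_half R; lra. Qed.

Lemma YN_glue (R : realType) r (x : nat -> R) s (y : s.-tuple R) :
  YN x -> in_cube y -> YN (glue r x y).
Proof.
move=> Yx Yy j; rewrite /glue; case: ifP => // _.
have [jy|jy] := ltnP (j - r) (size y); last by rewrite nth_default//; exact: Y0.
by apply: Yy; exact: mem_nth.
Qed.

Lemma YN_set (R : realType) r (x : nat -> R) t :
  YN x -> Y t -> YN [eta x with r |-> t].
Proof. by move=> Yx Yt j /=; case: eqP. Qed.

Lemma smooth_coord_continuous (R : realType) (F : (nat -> R) -> R) (l : seq nat)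
    r (x : nat -> R) : smooth F -> YN x ->
  {within `[- 2^-1, 2^-1],
    continuous (fun t : R => foldr (@partial R) F l [eta x with r |-> t])}.
Proof.
move=> /(_ l)[_ cF] Yx; set G := foldr _ _ _ in cF *.
apply/subspace_continuousP => t; rewrite /= in_itv /= -Y_itv => Yt.
have := (subspace_continuousP _ _).1 (cF r.+1 x Yx).
move=> /(_ [eta x with r |-> t] (YN_set r Yx Yt)).
have fix_up u : (fun j => if (j < r.+1)%N then [eta x with r |-> u] j else x j)
    = [eta x with r |-> u].
  apply/funext => j; case: ifP => //=; rewrite ltnS.
  by case: eqP => // ->; rewrite leqnn.
move=> cG A nA.
have {cG}nA' := cG A; rewrite /from_subspace fix_up in nA'; have {nA'}nA := nA' nA.
have c : (fun u : R => [eta x with r |-> u] : {ptws nat -> R}) u @[u --> t] -->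
    ([eta x with r |-> t] : {ptws nat -> R}).
  have Ff : Filter ((fun u : R => [eta x with r |-> u] : {ptws nat -> R}) @ nbhs t).
    exact: fmap_filter.
  apply/(@pointwise_cvgP _ _ _ _ Ff) => j /=.
  have : (if j == r then u else x j) @[u --> t] --> (if j == r then t else x j).
    by case: eqP => _; [exact: cvg_id|exact: cvg_cst].
  exact.
refine (@filterS _ (nbhs t) _ _ _ _ (c _ nA)) => u /= h Yu.
have Yu' : Y u by rewrite Y_itv; move: Yu; rewrite in_itv.
by have := h (YN_set r Yx Yu'); rewrite fix_up.
Qed.

(** At an interior point the increments that stay in [Y] form a neighborhood of
    [0], so the one-sided difference quotients are the ordinary ones. *)
Lemma smooth_coord_derive (R : realType) (F : (nat -> R) -> R) (l : seq nat)
    r (x : nat -> R) (t : R) : smooth F -> YN x -> - 2^-1 < t < 2^-1 ->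
  is_derive t (1 : R) (fun t : R => foldr (@partial R) F l [eta x with r |-> t])
    (foldr (@partial R) F (r :: l) [eta x with r |-> t]).
Proof.
move=> /(_ l)[dF _] Yx /andP[t1 t2]; set G := foldr _ _ l in dF *.
have Yt : Y t by rewrite Y_itv !ltW.
pose p := [eta x with r |-> t].
have pr : p r = t by rewrite /p /= eqxx.
have Yp : YN p := YN_set r Yx Yt.
have near_Y : \forall h \near 0^', Y (t + h).
  have e0 : 0 < Num.min (t + 2^-1) (2^-1 - t) by rewrite lt_min; lra.
  apply: nbhs_dnbhs; near=> h.
  have : `|0 - h| < Num.min (t + 2^-1) (2^-1 - t).
    by near: h; apply: (@cvgr_dist_lt _ _ _ (nbhs (0 : R)) _ id 0); [exact: cvg_id|].
  by rewrite sub0r normrN Y_itv lt_min !ltr_norml; lra.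
have q : (h^-1 *: (G [eta x with r |-> (h *: 1 + t)] - G [eta x with r |-> t]))
    @[h --> (0 : R)^'] --> partial r G p.
  have cq := dF r p Yp; rewrite /pderivable pr in cq.
  rewrite /partial pr => A /cq; rewrite /nbhs /= /Yincr /within /= => nA.
  rewrite /nbhs /=; near=> h.
  have Yh : Y (t + h) by near: h.
  have : Y (t + h) -> A (dquot r G p h) by near: h; exact: nA.
  move=> /(_ Yh); rewrite /preimage /=.
  suff -> : dquot r G p h =
      h^-1 *: (G [eta x with r |-> h *: 1 + t] - G [eta x with r |-> t]) by [].
  rewrite /dquot; congr (_ * (G _ - _)); apply/funext => j /=; case: eqP => // _.
  by rewrite eqxx [h *: 1]mulr1 addrC.
apply: DeriveDef; first by apply/cvg_ex; exists (partial r G p).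
by apply: cvg_lim => //; exact: norm_hausdorff.
Unshelve. all: by end_near. Qed.

(** The cube is compact by Tychonoff's theorem. *)
Lemma smooth_bounded (R : realType) (F : (nat -> R) -> R) (l : seq nat) r :
  smooth F -> exists M : R, forall x : nat -> R, YN x ->
    `|foldr (@partial R) F l (glue r x [::])| <= M.
Proof.
move=> /(_ l)[_ cF]; set G := foldr _ _ _ in cF *.
have cG := cF r (fun=> 0) (fun=> Y0 R).
have cpt : compact (@YN R : set {ptws nat -> R}).
  have := @tychonoff nat (fun=> R) (fun=> @Y R) (fun=> @segment_compact R _ _).
  exact.
have := compact_bounded (continuous_compact cG cpt).
case=> M0 [_ hM0]; exists (M0 + 1) => x Yx.
have -> : glue r x [::] = fun j => if (j < r)%N then x j else 0.
  by apply/funext => j; rewrite /glue nth_nil.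
by apply: (hM0 (M0 + 1)); [rewrite ltrDl|exists x].
Qed.

(** The list [l] records the derivatives taken in the first [r] coordinates,
    which are the ones frozen in [x]. *)
Lemma smooth_mixed_c1_glue (R : realType) (F : (nat -> R) -> R) s r (l : seq nat) :
  smooth F -> exists M : R, forall x : nat -> R, YN x ->
    mixed_c1 M (fun y : s.-tuple R => foldr (@partial R) F l (glue r x y)).
Proof.
move=> sF; elim: s r l => [|s IH] r l; first exact: smooth_bounded.
have [M1 h1] := IH r.+1 l; have [M2 h2] := IH r.+1 (r :: l).
exists (Num.max M1 M2) => x Yx /=.
exists (fun t (y : s.-tuple R) =>
  foldr (@partial R) F (r :: l) (glue r.+1 [eta x with r |-> t] y)); split.
- move=> t Yt; apply: (@mixed_c1_le _ M1); first by rewrite le_max lexx.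
  have := h1 _ (YN_set r Yx Yt); congr (mixed_c1 _ _).
  by apply/funext => y; rewrite -glue_cons.
- move=> t Yt; apply: (@mixed_c1_le _ M2); first by rewrite le_max lexx orbT.
  exact: h2 (YN_set r Yx Yt).
- move=> y Yy; have Yg := YN_glue r.+1 Yx Yy.
  have -> : (fun t => foldr (@partial R) F l (glue r x (cons_tuple t y))) =
      (fun t => foldr (@partial R) F l [eta glue r.+1 x y with r |-> t]).
    by apply/funext => t; rewrite -glue_set -glue_cons.
  have -> : (fun t => foldr (@partial R) F (r :: l) (glue r.+1 [eta x with r |-> t] y)) =
      (fun t => foldr (@partial R) F (r :: l) [eta glue r.+1 x y with r |-> t]).
    by apply/funext => t; rewrite glue_set.
  split; [exact: smooth_coord_continuous|exact: smooth_coord_continuous|].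
  by move=> t ht; exact: smooth_coord_derive.
Qed.

Lemma smooth_mixed_c1 (R : realType) (F : (nat -> R) -> R) s : smooth F ->
  exists M : R, mixed_c1 M (fun y : s.-tuple R => F (ext0 y)).
Proof.
move=> sF; have [M h] := @smooth_mixed_c1_glue R F s 0 [::] sF; exists M.
have := h (fun=> 0) (fun=> Y0 R); congr (mixed_c1 _ _).
by apply/funext => y; congr F; apply/funext => j; rewrite /glue ltn0 subn0.
Qed.

(** * The error bound *)

(** Raising [k] by one removes the last term and adds one that equals it by
    periodicity. *)
Lemma sum_shift_period (R : realType) n (H : int -> R) (k : nat) :
  (forall x, H (x + n%:Z) = H x) ->
  \sum_(1 <= i < n.+1) H (i%:Z - k%:Z) = \sum_(1 <= i < n.+1) H i%:Z.
Proof.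
move=> Hn; elim: k => [|k IH]; first by apply: eq_bigr => i _; rewrite subr0.
rewrite -IH; apply/eqP; rewrite -subr_eq0 -sumrB.
pose T (i : nat) := - H (i%:Z - k.+1%:Z).
rewrite (eq_bigr (fun i => T i.+1 - T i)); last first.
  move=> i _; rewrite /T opprK addrC; congr (- H _ + _); lia.
rewrite telescope_sumr// /T opprK addrC subr_eq0 -[X in X == _]Hn.
by apply/eqP; congr H; lia.
Qed.

Lemma lattice_mean_set0 (R : realType) s n (z : 'I_s -> nat) : (0 < n)%N ->
  lattice_mean R n z finset.set0 = 1.
Proof.
move=> n0; rewrite /lattice_mean; under eq_bigr do rewrite big_set0.
by rewrite sumr_const_nat subn1 /= mulVf// pnatr_eq0 -lt0n.
Qed.

Lemma sum_lattice_mean (R : realType) s n (z : 'I_s -> nat) :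
  n%:R^-1 * \sum_(1 <= i < n.+1)
    \prod_(j < s) (1 + B2 (frac_part ((i * z j)%:R / n%:R : R))) =
  \sum_(u : {set 'I_s}) lattice_mean R n z u.
Proof.
rewrite /lattice_mean -mulr_sumr exchange_big /=; congr (_ * _).
apply: eq_bigr => i _; under eq_bigr do rewrite addrC.
by rewrite bigA_distr; apply: eq_bigr => u _; rewrite [RHS]big_mkcond.
Qed.

(** Averaging the pointwise kernel bound over the shift turns the kernel into
    a function of the differences of the lattice points, and these differences
    run over the lattice itself. *)
Lemma shift_mse_le (R : realType) (M : R) s n (z : 'I_s -> nat)
    (F : (nat -> R) -> R) : (0 < n)%N ->
  mixed_c1 M (fun y : s.-tuple R => F (ext0 y)) ->
  0 <= shift_expectation (fun D : s.-tuple R =>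
      `|trunc_integral s F - lattice_rule n z F D| ^+ 2)
    <= 2 ^+ s * M ^+ 2 * \sum_(u : {set 'I_s} | u != finset.set0) lattice_mean R n z u.
Proof.
move=> n0 FM; set B := 2 ^+ s * M ^+ 2.
have nn0 : (n%:R : R) != 0 by rewrite pnatr_eq0 -lt0n.
pose r := index_iota 1 n.+1.
pose zn (j : nat) : nat := if insub j is Some o then z o else 0%N.
have znE (j : 'I_s) : zn j = z j by rewrite /zn valK.
pose pt (i j : nat) (D : R) : R := frac_part ((i * zn j)%:R / n%:R + D) - 2^-1.
pose g (ik : nat * nat) (j : nat) (D : R) : R :=
  1 + anova_cov (pt ik.1 j D) (pt ik.2 j D).
pose v (ik : nat * nat) (j : nat) : R :=
  1 + B2 (frac_part ((ik.1 * zn j)%:R / n%:R - (ik.2 * zn j)%:R / n%:R)).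
have gv ik j : has_int 0 1 (g ik j) (v ik j).
  apply: has_intD (has_int_shift_cov _ _).
  by apply: has_int_eq (has_int_cst 1 ler01) => //; rewrite subr0 mulr1.
pose rr := [seq (i, k) | i <- r, k <- r].
have fb (D : s.-tuple R) : (forall x, x \in (D : seq R) -> 0 < x < 1) ->
    0 <= `|trunc_integral s F - lattice_rule n z F D| ^+ 2 <=
    - B + \sum_(ik <- rr) B * n%:R^-1 ^+ 2 * \prod_(0 <= j < s) g ik j (nth 0 D j).
  move=> _; rewrite sqr_ge0 real_normK ?num_real//=.
  pose x i : s.-tuple R :=
    [tuple frac_part ((i * z j)%:R / n%:R + tnth D j) - 2^-1 | j < s].
  have Yx i : in_cube (x i).
    move=> _ /tnthP[j ->]; rewrite tnth_mktuple Y_itv.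
    by have := frac_part_ge0_lt1 ((i * z j)%:R / n%:R + tnth D j); lra.
  have := functional_sq_le r (fun=> - n%:R^-1) 1 FM Yx.
  have -> : 1 * cube_integral (@Y R) (fun y : s.-tuple R => F (ext0 y)) +
      \sum_(i <- r) - n%:R^-1 * F (ext0 (x i)) =
      trunc_integral s F - lattice_rule n z F D.
    by rewrite mul1r -mulr_sumr mulNr.
  have -> : \sum_(i <- r) - n%:R^-1 = -1 :> R.
    by rewrite sumr_const_nat subn1 /= mulNrn -[X in - X]mulr_natr mulVf.
  have -> : \sum_(i <- r) \sum_(k <- r) - n%:R^-1 * - n%:R^-1 * cov_prod (x i) (x k) =
      \sum_(ik <- rr) n%:R^-1 ^+ 2 * \prod_(0 <= j < s) g ik j (nth 0 D j).
    rewrite big_allpairs; apply: eq_bigr => i _; apply: eq_bigr => k _.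
    rewrite mulrNN -expr2 /cov_prod big_mkord; congr (_ * _).
    apply: eq_bigr => j _; rewrite !tnth_mktuple /g /pt /= znE.
    by rewrite (tnth_nth 0).
  move=> h; apply: (le_trans h); rewrite le_eqVlt; apply/orP; left; apply/eqP.
  under [X in _ = _ + X]eq_bigr do rewrite -mulrA.
  by rewrite -[in RHS]mulr_sumr -/B; set S := \sum_(_ <- rr) _; ring.
have /andP[-> h] := shift_expectation_le gv fb; apply: (le_trans h).
rewrite le_eqVlt; apply/orP; left; apply/eqP.
pose H (y : int) : R := \prod_(j < s) (1 + B2 (frac_part ((y * (z j)%:Z)%:~R / n%:R))).
have H_period y : H (y + n%:Z) = H y.
  apply: eq_bigr => j _; congr (1 + B2 _).
  rewrite -[RHS](frac_part_add_int _ (z j)%:Z); congr frac_part.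
  by rewrite mulrDl rmorphD /= [(n%:Z * _)%:~R]rmorphM /=; field.
have prodE i k : \prod_(0 <= j < s) v (i, k) j = H (i%:Z - k%:Z).
  rewrite big_mkord; apply: eq_bigr => j _; rewrite /v /= znE; congr (1 + B2 (frac_part _)).
  by rewrite mulrBl rmorphB /= -!PoszM mulrBl.
have -> : \sum_(ik <- rr) B * n%:R^-1 ^+ 2 * \prod_(0 <= j < s) v ik j =
    B * \sum_(u : {set 'I_s}) lattice_mean R n z u.
  rewrite big_allpairs exchange_big /=.
  under eq_bigr do under eq_bigr do rewrite prodE.
  under eq_bigr do rewrite -mulr_sumr sum_shift_period//.
  rewrite sumr_const_nat subn1 /= -sum_lattice_mean -[_ *+ n]mulr_natr.
  have -> : \sum_(1 <= i < n.+1) H i%:Z = \sum_(1 <= i < n.+1)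
      \prod_(j < s) (1 + B2 (frac_part ((i * z j)%:R / n%:R : R))).
    by apply: eq_bigr => i _; apply: eq_bigr => j _; rewrite -PoszM.
  by field.
rewrite (bigD1 finset.set0)//= lattice_mean_set0//; ring.
Qed.

Lemma vartheta_bounds (R : realType) (delta p omega : R) : 1 <= delta -> 0 < p ->
  p <= delta^-1 -> 2^-1 < omega -> omega < 1 -> 2^-1 < vartheta delta p omega <= 1.
Proof.
move=> d1 p0 pd o1 o2; rewrite /vartheta; case: (leP p) => [_|]; first by rewrite o1 ltW.
have d0 : 0 < delta by lra.
have dp : delta * p <= 1 by rewrite -ler_pdivlMl// mulr1.
rewrite ltr_pdivrMr ?mulr_gt0// => h.
have den : 0 < 2 - delta * p by lra.
rewrite ltr_pdivlMr// ler_pdivrMr//; nra.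
Qed.

Lemma weight_gt0 (R : realType) (delta theta : R) (beta : nat -> R) s (u : {set 'I_s}) :
  2^-1 < theta -> (forall j, 0 < beta j) -> 0 < weight delta theta beta u.
Proof.
move=> th b0; rewrite /weight; apply: powR_gt0; apply: mulr_gt0.
  by rewrite powR_gt0// ltr0n fact_gt0.
apply: prodr_gt0 => j _; rewrite divr_gt0// sqrtr_gt0 /phi divr_gt0//.
  by rewrite mulr_gt0// zeta_gt0//; lra.
by rewrite powR_gt0// mulr_gt0// exprn_gt0// pi_gt0.
Qed.

Theorem lemma7p4 (R : realType) (F : (nat -> R) -> R)
    (delta p CF : R) (beta : nat -> R) (s : nat) (omega : R)
    (F_smooth : smooth F)
    (delta_ge1 : 1 <= delta)
    (p_gt0 : 0 < p) (p_le : p <= delta^-1)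
    (CF_gt0 : 0 < CF)
    (beta_gt0 : forall j, 0 < beta j)
    (F_bound : forall (xi : nat -> R) (nu : mindex), YN xi ->
       `|mpartial nu F xi| <= CF * mpow beta nu * (mlen nu)`!%:R `^ delta)
    (beta_lp : (lpnorm p beta < +oo)%E)
    (beta_lp_crit : p = delta^-1 -> (lpnorm p beta < (Num.sqrt 6)%:E)%E)
    (s_gt0 : (0 < s)%N)
    (omega_gt : 2^-1 < omega) (omega_lt : omega < 1) :
  let theta := vartheta delta p omega in
  let gamma : {set 'I_s} -> R := weight delta theta beta (s := s) in
  exists C : R, 0 < C /\
    forall (m : nat) (z : 'I_s -> nat), (0 < m)%N ->
      let n := (2 ^ m)%N in
      cbc n gamma z ->
      Num.sqrt (shift_expectation (fun Delta =>
                  `|trunc_integral s F - lattice_rule n z F Delta| ^+ 2))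
        <= Num.sqrt C * (n%:R / 2) `^ (- (1 / (2 * theta))).
Proof.
move=> theta gamma.
have theta01 : 2^-1 < theta <= 1 by exact: vartheta_bounds.
have gamma0 v : 0 < gamma v by apply: weight_gt0 => //; lra.
have [M FM] := @smooth_mixed_c1 R F s F_smooth.
have [K K0 meanK] := cbc_lattice_mean_le theta01 gamma0.
pose B := 2 ^+ s * M ^+ 2; have B0 : 0 <= B by rewrite mulr_ge0 ?sqr_ge0// exprn_ge0.
pose S := \sum_(u : {set 'I_s} | u != finset.set0) K / gamma u.
have S0 : 0 <= S by rewrite sumr_ge0// => u _; rewrite divr_ge0 ?ltW.
exists (1 + B * S); split; first by rewrite ltr_pwDl// mulr_ge0.
move=> m z m0 n cz; set X := (n%:R / 2) `^ _.
have n0 : (0 < n)%N by rewrite expn_gt0.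
have /andP[_ mse] := shift_mse_le z n0 FM.
pose rate := (n%:R / 2 : R) `^ (- theta^-1).
have rateE : Num.sqrt rate = X.
  rewrite -powR12_sqrt ?powR_ge0// -powRrM /X; congr (_ `^ _).
  by field; rewrite gt_eqF//; lra.
rewrite -rateE -sqrtrM; last by rewrite addr_ge0// mulr_ge0.
apply: ler_wsqrtr; apply: (le_trans mse).
apply: (le_trans (y := B * S * rate)); last by rewrite ler_wpM2r ?powR_ge0// lerDr.
rewrite -/B -[B * S * _]mulrA ler_wpM2l// /S mulr_suml; apply: ler_sum => u u0.
rewrite -mulrA [_^-1 * _]mulrC mulrA ler_pdivlMr// mulrC.
exact: meanK.
Qed.
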